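(* Let $\mathcal M$ be a symplectic $\mathbb N$-manifold of degree 2 corresponding to the pseudo-euclidean vector bundle $E\to M$, and let $\mathcal N$ be a lagrangian submanifold of $\mathcal M$, defined by a lagrangian subbundle $K\to N$ of $E|_N$, $N\subseteq M$ a submanifold. Let $\Theta\in C(\mathcal M)_3$ be a Courant function, with corresponding Courant algebroid structure on $E$ with anchor $\rho$ and bracket $[\![\cdot,\cdot]\!]$. The following are equivalent: (a) $\Theta$ is reducible with respect to $\mathcal N$, i.e., $\{\Theta,\mathcal I\}\subseteq\mathcal I$, where $\mathcal I$ is the sheaf of vanishing ideals of $\mathcal N$; (b) $\rho(K)\subseteq TN$ and, for any sections $e_1,e_2\in\Gamma(E)$ with $e_1|_N,e_2|_N\in\Gamma(K)$, we have $[\![e_1,e_2]\!]|_N\in\Gamma(K)$.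
   Context: Manifolds and vector bundles are smooth and real; $\Gamma_A$ is the sheaf of sections of $A$. **$\mathbb N$-manifolds.** An $\mathbb N$-manifold of degree 2 is a pair $\mathcal M=(M,C_{\mathcal M})$ with $M$ (the body) a manifold and $C_{\mathcal M}$ a sheaf of graded-commutative algebras on $M$, locally isomorphic to $C^\infty_U\otimes\wedge\mathbb R^{m_1}\otimes\mathrm S\,\mathbb R^{m_2}$ (sheafified; $\mathbb R^{m_q}$ in degree $q$). $C(\mathcal M)_k$ denotes global sections of degree $k$. **Symplectic structures.** A symplectic $\mathbb N$-manifold of degree 2 carries a non-degenerate degree $-2$ Poisson bracket on $C_{\mathcal M}$. It corresponds to a pseudo-euclidean vector bundle $(E,\langle\cdot,\cdot\rangle)$ over $M$ (fiberwise symmetric non-degenerate form): writing $\mathbb A_E$ for its Atiyah algebroid, whose sections are pairs $(X,D)$ of a vector field $X$ (symbol) and an $\mathbb R$-linear $D\colon\Gamma(E)\to\Gamma(E)$ with $D(fe)=(\mathcal L_Xf)e+fD(e)$ and $\mathcal L_X\langle e,e'\rangle=\langle De,e'\rangle+\langle e,De'\rangle$, one has $(C_{\mathcal M})_0=C^\infty_M$, $(C_{\mathcal M})_1=\Gamma_E$, $(C_{\mathcal M})_2=\Gamma_{\mathbb A_E}$ (generating $C_{\mathcal M}$; products of degree-1 functions are given by $\wedge^2E\cong\mathfrak{so}(E)\subseteq\mathbb A_E$). For $|f|=k$, $|g|=l$: $\{f,g\}=-(-1)^{kl}\{g,f\}$, $\{f,gh\}=\{f,g\}h+(-1)^{kl}g\{f,h\}$,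 $\{f,\{g,h\}\}=\{\{f,g\},h\}+(-1)^{kl}\{g,\{f,h\}\}$; the bracket is determined by $\{e_1,e_2\}=\langle e_1,e_2\rangle$, $\{(X,D),f\}=\mathcal L_Xf$, $\{(X,D),e\}=D(e)$, $\{(X_1,D_1),(X_2,D_2)\}=([X_1,X_2],[D_1,D_2])$. **Courant functions.** $\Theta\in C(\mathcal M)_3$ is a Courant function if $\{\Theta,\Theta\}=0$. It is equivalent to a Courant algebroid structure on $E$ (bundle map $\rho\colon E\to TM$ and bilinear bracket on $\Gamma(E)$) via $\mathcal L_{\rho(e)}f=\{\{\Theta,e\},f\}$, $[\![e_1,e_2]\!]=\{\{\Theta,e_1\},e_2\}$. **Lagrangian submanifolds.** Lagrangian submanifolds of $\mathcal M$ correspond bijectively to subbundles $K\to N$ of $E$ supported on submanifolds $N\subseteq M$ with $K=K^\perp$ (lagrangian subbundles): the lagrangian submanifold defined by $K$ has body $N$ and sheaf of vanishing ideals $\mathcal I\subseteq C_{\mathcal M}$ generated by $\mathcal I_0=I_N$ (functions vanishing on $N$), $\mathcal I_1$ = sections of $E$ whose restriction to $N$ lies in $K$ (denoted $\Gamma_{E,K}$), and $\mathcal I_2$ = sections $(X,D)$ of $\mathbb A_E$ with $X$ tangent to $N$ along $N$ and $D(\Gamma_{E,K})\subseteq\Gamma_{E,K}$. *)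

(* Defs.v *)
From HB Require Import structures.
From mathcomp Require Import all_boot all_order all_algebra.
From mathcomp Require Import all_classical all_reals all_analysis.

Set Implicit Arguments.
Unset Strict Implicit.
Unset Printing Implicit Defensive.

Import Order.TTheory GRing.Theory Num.Theory.
Import numFieldNormedType.Exports.

Local Open Scope classical_set_scope.
Local Open Scope ring_scope.

(* Throughout, local objects (functions, sections, operators on sections over
   an open set U) are represented by total ones of which only the values on U
   matter; every notion below carries the open set as an argument and
   identifies objects that agree on it. *)

(* C^k on an open set; for k > 0, all directional derivatives exist and are
   C^(k-1). *)
Fixpoint Ck (R : realType) (n k : nat) (U : set 'rV[R]_n)
    (f : 'rV[R]_n -> R) : Prop :=
  (forall x, U x -> {for x, continuous f}) /\
  if k is k'.+1 then
    forall v : 'rV[R]_n, (forall x, U x -> derivable f x v) /\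
      Ck k' U (fun x => 'D_v f x)
  else True.

Definition Cinfty (R : realType) (n : nat) (U : set 'rV[R]_n)
    (f : 'rV[R]_n -> R) : Prop := forall k, Ck k U f.

Record chart (R : realType) (T : topologicalType) (n : nat) := Chart {
  cdom : set T;
  cmap : T -> 'rV[R]_n;
  cinv : 'rV[R]_n -> T;
  cdom_open : open cdom;
  cimg_open : open (cmap @` cdom);
  cmapK : forall x, cdom x -> cinv (cmap x) = x;
  cmap_cont : forall x, cdom x -> {for x, continuous cmap};
  cinv_cont : forall y, (cmap @` cdom) y -> {for y, continuous cinv} }.

Definition transition_smooth (R : realType) (T : topologicalType) (n : nat)
    (c c' : chart R T n) : Prop :=
  forall j : 'I_n, Cinfty (cmap c @` (cdom c `&` cdom c'))
                          (fun y => cmap c' (cinv c y) ord0 j).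

Record manifold (R : realType) := Manifold {
  mtop :> topologicalType;
  mdim : nat;
  atlas : set (chart R mtop mdim);
  mhausdorff : hausdorff_space mtop;
  msecond_countable : @second_countable mtop;
  atlas_cover : forall x, exists2 c, atlas c & cdom c x;
  atlas_compat : forall c c', atlas c -> atlas c' -> transition_smooth c c' }.

Section OnManifold.
Context {R : realType} {M : manifold R}.

(* the charts of the maximal atlas *)
Definition admissible (c : chart R M (mdim M)) : Prop :=
  forall c', atlas c' -> transition_smooth c c' /\ transition_smooth c' c.

Definition smooth_on (U : set M) (f : M -> R) : Prop :=
  forall c, atlas c -> Cinfty (cmap c @` (U `&` cdom c)) (f \o cinv c).

(* v is the derivative at x, along the vector w in the coordinates c, of
   functions defined and smooth near x *)
Definition directional (c : chart R M (mdim M)) (x : M)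
    (w : 'rV[R]_(mdim M)) (v : (M -> R) -> R) : Prop :=
  forall (U : set M) f, open U -> U x -> smooth_on U f ->
    v f = 'D_w (f \o cinv c) (cmap c x).

(* Tangent vectors at x are represented by their action on functions that are
   smooth near x; two of them are equal when these actions agree. *)
Definition tangent_vector (x : M) (v : (M -> R) -> R) : Prop :=
  exists (c : chart R M (mdim M)) (w : 'rV[R]_(mdim M)),
    [/\ atlas c, cdom c x & directional c x w v].

(* X f is the Lie derivative of f along X; X f x only depends on the germ of
   f at x. *)
Definition vector_field (U : set M) (X : (M -> R) -> M -> R) : Prop :=
  (forall x, U x -> tangent_vector x (fun f => X f x)) /\
  (forall V f, open V -> V `<=` U -> smooth_on V f -> smooth_on V (X f)).

Definition slice_chart (N : set M) (d : nat) (c : chart R M (mdim M)) : Prop :=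
  admissible c /\
  forall x, cdom c x ->
    (N x <-> forall j : 'I_(mdim M), (d <= j)%N -> cmap c x ord0 j = 0).

(* embedded submanifolds, not necessarily closed *)
Definition submanifold (N : set M) (d : nat) : Prop :=
  (d <= mdim M)%N /\
  forall x, N x -> exists2 c, slice_chart N d c & cdom c x.

(* v belongs to T_x N, for x in N: in a slice chart, it is a combination of
   the first d coordinate vectors *)
Definition tangent_to (N : set M) (d : nat) (x : M) (v : (M -> R) -> R) : Prop :=
  exists (c : chart R M (mdim M)) (w : 'rV[R]_(mdim M)),
  [/\ slice_chart N d c, cdom c x,
    (forall j : 'I_(mdim M), (d <= j)%N -> w ord0 j = 0) & directional c x w v].

End OnManifold.

Record vbundle (R : realType) (M : manifold R) := VBundle {
  fib :> M -> lmodType R;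
  vrank : nat;
  tidx : Type;
  tdom : tidx -> set M;
  tmap : tidx -> forall x, fib x -> 'rV[R]_vrank;
  tdom_open : forall i, open (tdom i);
  tdom_cover : forall x, exists i, tdom i x;
  tmap_linear : forall i x, tdom i x -> linear (@tmap i x);
  tmap_bij : forall i x, tdom i x -> bijective (@tmap i x);
  tmap_transition : forall i j, exists T : M -> 'M[R]_vrank,
    (forall a b, smooth_on (tdom i `&` tdom j) (fun x => T x a b)) /\
    (forall x, tdom i x -> tdom j x ->
       forall u, @tmap j x u = @tmap i x u *m T x) }.
Arguments tmap {R M v} i x u.

Section Sections.
Context {R : realType} {M : manifold R} (E : vbundle M).

Definition section : Type := forall x, E x.

Definition smooth_sec (U : set M) (s : section) : Prop :=
  forall i a, smooth_on (U `&` tdom i) (fun x => tmap i x (s x) ord0 a).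

Definition secD (s t : section) : section := fun x => s x + t x.
Definition secZ (f : M -> R) (s : section) : section := fun x => f x *: s x.

(* Bundle maps E -> TM over the identity of M; rho x u is a tangent vector. *)
Definition bundle_map_TM (rho : forall x, E x -> (M -> R) -> R) : Prop :=
  [/\ (forall x u, tangent_vector x (rho x u)),
      (forall x (a : R) u v (U : set M) f, open U -> U x -> smooth_on U f ->
         rho x (a *: u + v) f = a * rho x u f + rho x v f)
    & (forall (U : set M) s f, open U -> smooth_sec U s -> smooth_on U f ->
         smooth_on U (fun x => rho x (s x) f))].

End Sections.

Record pe_bundle (R : realType) (M : manifold R) := PEBundle {
  pe_vb :> vbundle M;
  ip : forall x, pe_vb x -> pe_vb x -> R;
  ip_sym : forall x u v, @ip x u v = ip v u;
  ip_linear : forall x (a : R) u v w,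
    @ip x (a *: u + v) w = a * ip u w + ip v w;
  ip_nondeg : forall x u, (forall v, @ip x u v = 0) -> u = 0;
  ip_smooth : forall (U : set M) (s t : section pe_vb), open U ->
    smooth_sec U s -> smooth_sec U t -> smooth_on U (fun x => ip (s x) (t x)) }.

Section Atiyah.
Context {R : realType} {M : manifold R} (E : pe_bundle M).

(* Sections (X, D) over U of the Atiyah algebroid of E. An R-linear operator on
   Gamma(U, E) with a symbol is local, hence acts on the sections over every
   open V contained in U; D stands for the resulting operator on the sheaf of
   sections of E over U. *)
Definition atiyah (U : set M) (X : (M -> R) -> M -> R)
    (D : section E -> section E) : Prop :=
  vector_field U X /\
  forall V, open V -> V `<=` U ->
  [/\ (forall s, smooth_sec V s -> smooth_sec V (D s)),
      (forall s t, smooth_sec V s -> smooth_sec V t ->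
         (forall x, V x -> s x = t x) -> forall x, V x -> D s x = D t x),
      (forall (a : R) s t, smooth_sec V s -> smooth_sec V t -> forall x, V x ->
         D (secD (secZ (fun=> a) s) t) x = a *: D s x + D t x),
      (forall f s, smooth_on V f -> smooth_sec V s -> forall x, V x ->
         D (secZ f s) x = X f x *: s x + f x *: D s x)
    & (forall s t, smooth_sec V s -> smooth_sec V t -> forall x, V x ->
         X (fun y => ip (s y) (t y)) x = ip (D s x) (t x) + ip (s x) (D t x))].

Definition atiyah_eq (U : set M) (X X' : (M -> R) -> M -> R)
    (D D' : section E -> section E) : Prop :=
  forall V, open V -> V `<=` U ->
    (forall f, smooth_on V f -> forall x, V x -> X f x = X' f x) /\
    (forall s, smooth_sec V s -> forall x, V x -> D s x = D' s x).

End Atiyah.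

(* A sheaf of graded-commutative algebras C on M with C_0 identified, by fn,
   with the sheaf of smooth functions. [shf U] is the direct sum of its
   homogeneous parts [hdeg k], each of which is a sheaf; it may be the zero
   ring (as over the empty set), and its scalars are the constant functions. *)
Record graded_sheaf (R : realType) (M : manifold R) := GradedSheaf {
  shf :> set M -> pzRingType;
  hdeg : forall U, nat -> set (shf U);
  res : forall U V, shf U -> shf V;
  fn : forall U, (M -> R) -> shf U;
  hdeg0 : forall U k, open U -> @hdeg U k 0;
  hdegB : forall U k a b, open U ->
    @hdeg U k a -> hdeg k b -> hdeg k (a - b);
  hdegM : forall U k l a b, open U ->
    @hdeg U k a -> hdeg l b -> hdeg (k + l) (a * b);
  hdeg_comm : forall U k l a b, open U ->
    @hdeg U k a -> hdeg l b -> a * b = (-1) ^+ (k * l) * (b * a);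
  hdeg_sum : forall U (a : shf U), open U -> exists n (b : nat -> shf U),
    (forall k, hdeg k (b k)) /\ a = \sum_(k < n) b k;
  hdeg_free : forall U n (b : nat -> shf U), open U ->
    (forall k, hdeg k (b k)) -> \sum_(k < n) b k = 0 ->
    forall k, (k < n)%N -> b k = 0;
  res_id : forall U a, open U -> @res U U a = a;
  res_comp : forall U V W (a : shf U), open U -> open V -> open W ->
    V `<=` U -> W `<=` V -> res W (res V a) = res W a;
  resB : forall U V (a b : shf U), open U -> open V -> V `<=` U ->
    res V (a - b) = res V a - res V b;
  resM : forall U V (a b : shf U), open U -> open V -> V `<=` U ->
    res V (a * b) = res V a * res V b;
  res1 : forall U V, open U -> open V -> V `<=` U -> res V (1 : shf U) = 1;
  res_hdeg : forall U V k (a : shf U), open U -> open V -> V `<=` U ->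
    hdeg k a -> hdeg k (res V a);
  shf_sep : forall (F : set (set M)) (a : shf (\bigcup_(V in F) V)),
    (forall V, F V -> open V) -> (forall V, F V -> res V a = 0) -> a = 0;
  shf_glue : forall (F : set (set M)) k (s : forall V, shf V),
    (forall V, F V -> open V) -> (forall V, F V -> hdeg k (s V)) ->
    (forall V W, F V -> F W ->
       res (V `&` W) (s V) = res (V `&` W) (s W)) ->
    exists2 a : shf (\bigcup_(V in F) V),
      hdeg k a & forall V, F V -> res V a = s V;
  fn_hdeg : forall U f, open U -> smooth_on U f -> hdeg 0 (fn U f);
  fn_onto : forall U a, open U -> @hdeg U 0 a ->
    exists2 f, smooth_on U f & a = fn U f;
  fn_eq : forall U f g, open U -> smooth_on U f -> smooth_on U g ->
    (fn U f = fn U g <-> forall x, U x -> f x = g x);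
  fn1 : forall U, open U -> fn U (fun=> 1) = 1;
  fnD : forall U f g, open U -> smooth_on U f -> smooth_on U g ->
    fn U (fun x => f x + g x) = fn U f + fn U g;
  fnM : forall U f g, open U -> smooth_on U f -> smooth_on U g ->
    fn U (fun x => f x * g x) = fn U f * fn U g;
  res_fn : forall U V f, open U -> open V -> V `<=` U -> smooth_on U f ->
    res V (fn U f) = fn V f }.
Arguments hdeg {R M g0 U} k a.
Arguments res {R M g0 U} V a.
Arguments fn {R M} g0 U f.

Section Coordinates.
Context {R : realType} {M : manifold R} (C : graded_sheaf M) (m1 m2 : nat).
Variables (U : set M) (xi : 'I_m1 -> C U) (p : 'I_m2 -> C U).

(* the element of degree k over V with coefficients c I J in the monomials
   xi^I p^J such that |I| + 2 |J| = k *)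
Definition coord_expr (V : set M) (k : nat)
    (c : {set 'I_m1} -> {ffun 'I_m2 -> 'I_k.+1} -> M -> R) : C V :=
  \sum_(I : {set 'I_m1})
    \sum_(J : {ffun 'I_m2 -> 'I_k.+1} | (#|I| + 2 * \sum_j J j)%N == k)
      fn C V (c I J) *
      ((\prod_(i in I) res V (xi i)) * \prod_j res V (p j) ^+ J j).

(* xi and p are the images of the canonical generators under an isomorphism
   from C^oo_U (x) /\ R^m1 (x) S R^m2 to C over U, i.e. their monomials form a
   basis of C over the smooth functions. *)
Definition local_coords : Prop :=
  [/\ (forall i, hdeg 1 (xi i)), (forall j, hdeg 2 (p j)) &
   forall V k, open V -> V `<=` U ->
     (forall a : C V, hdeg k a -> exists c,
        (forall I J, smooth_on V (c I J)) /\ a = @coord_expr V k c) /\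
     (forall c, (forall I J, smooth_on V (c I J)) -> @coord_expr V k c = 0 ->
        forall (I : {set 'I_m1}) (J : {ffun 'I_m2 -> 'I_k.+1}),
          (#|I| + 2 * \sum_j J j)%N = k -> forall x, V x -> c I J x = 0)].

End Coordinates.

Record Nmanifold2 (R : realType) (M : manifold R) := NManifold2 {
  nshf :> graded_sheaf M;
  ndim1 : nat;
  ndim2 : nat;
  nlocal : forall x, exists (U : set M) (xi : 'I_ndim1 -> nshf U)
      (p : 'I_ndim2 -> nshf U),
    [/\ open U, U x & local_coords xi p] }.

Record symplectic (R : realType) (M : manifold R) (C : Nmanifold2 M) :=
    Symplectic {
  pb : forall U, C U -> C U -> C U;
  pbDl : forall U (a b c : C U), open U -> pb (a + b) c = pb a c + pb b c;
  pbDr : forall U (a b c : C U), open U -> pb a (b + c) = pb a b + pb a c;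
  pbZl : forall U (r : R) (a b : C U), open U ->
    pb (fn C U (fun=> r) * a) b = fn C U (fun=> r) * pb a b;
  pbZr : forall U (r : R) (a b : C U), open U ->
    pb a (fn C U (fun=> r) * b) = fn C U (fun=> r) * pb a b;
  res_pb : forall U V (a b : C U), open U -> open V -> V `<=` U ->
    res V (pb a b) = pb (res V a) (res V b);
  pb_hdeg : forall U k l m (a b : C U), open U -> hdeg k a -> hdeg l b ->
    (k + l)%N = (m + 2)%N -> hdeg m (pb a b);
  pb_low : forall U k l (a b : C U), open U -> hdeg k a -> hdeg l b ->
    (k + l < 2)%N -> pb a b = 0;
  pb_anti : forall U k l (a b : C U), open U -> hdeg k a -> hdeg l b ->
    pb a b = - ((-1) ^+ (k * l) * pb b a);
  pb_leibniz : forall U k l m (a b c : C U), open U ->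
    hdeg k a -> hdeg l b -> hdeg m c ->
    pb a (b * c) = pb a b * c + (-1) ^+ (k * l) * (b * pb a c);
  pb_jacobi : forall U k l m (a b c : C U), open U ->
    hdeg k a -> hdeg l b -> hdeg m c ->
    pb a (pb b c) = pb (pb a b) c + (-1) ^+ (k * l) * pb b (pb a c);
  (* In local coordinates (x, xi, p) of degrees 0, 1, 2, the degree 0 part of
     the matrix of the bracket consists of the blocks {xi, xi} and {p, x} (and
     {x, p}), which must be square and invertible at every point. *)
  pb_nondeg : forall U (xi : 'I_(ndim1 C) -> C U) (p : 'I_(ndim2 C) -> C U)
      (c : chart R M (mdim M))
      (G : 'I_(ndim1 C) -> 'I_(ndim1 C) -> M -> R)
      (H : 'I_(ndim2 C) -> 'I_(mdim M) -> M -> R),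
    open U -> local_coords xi p -> atlas c -> U `<=` cdom c ->
    (forall i j, smooth_on U (G i j)) -> (forall i j, smooth_on U (H i j)) ->
    (forall i j, pb (xi i) (xi j) = fn C U (G i j)) ->
    (forall i j, pb (p i) (fn C U (fun y => cmap c y ord0 j)) =
                 fn C U (H i j)) ->
    forall x, U x ->
      (\matrix_(i, j) G i j x \in unitmx) /\
      row_free (\matrix_(i, j) H i j x) && row_full (\matrix_(i, j) H i j x) }.
Arguments pb {R M C} s {U} a b.

(* The symplectic N-manifold (C, S) corresponds to the bundle E: C_1 is
   identified with the sections of E by [sec] and C_2 with the sections of its
   Atiyah algebroid by [ati], as sheaves of modules over the smooth functions,
   with the prescribed brackets. *)
Record corresponds (R : realType) (M : manifold R) (C : Nmanifold2 M)
    (S : symplectic C) (E : pe_bundle M) := Corresponds {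
  sec : forall U, section E -> C U;
  ati : forall U, ((M -> R) -> M -> R) -> (section E -> section E) -> C U;
  sec_hdeg : forall U s, open U -> smooth_sec U s -> hdeg 1 (sec U s);
  sec_onto : forall U (a : C U), open U -> hdeg 1 a ->
    exists2 s, smooth_sec U s & a = sec U s;
  sec_eq : forall U s t, open U -> smooth_sec U s -> smooth_sec U t ->
    (sec U s = sec U t <-> forall x, U x -> s x = t x);
  sec_add : forall U s t, open U -> smooth_sec U s -> smooth_sec U t ->
    sec U (secD s t) = sec U s + sec U t;
  sec_scale : forall U f s, open U -> smooth_on U f -> smooth_sec U s ->
    sec U (secZ f s) = fn C U f * sec U s;
  res_sec : forall U V s, open U -> open V -> V `<=` U -> smooth_sec U s ->
    res V (sec U s) = sec V s;
  ati_hdeg : forall U X D, open U -> atiyah U X D -> hdeg 2 (ati U X D);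
  ati_onto : forall U (a : C U), open U -> hdeg 2 a ->
    exists X D, atiyah U X D /\ a = ati U X D;
  ati_eq : forall U X X' D D', open U -> atiyah U X D -> atiyah U X' D' ->
    (ati U X D = ati U X' D' <-> atiyah_eq U X X' D D');
  ati_add : forall U X X' D D', open U -> atiyah U X D -> atiyah U X' D' ->
    ati U (fun f x => X f x + X' f x) (fun s => secD (D s) (D' s)) =
    ati U X D + ati U X' D';
  ati_scale : forall U f X D, open U -> smooth_on U f -> atiyah U X D ->
    ati U (fun g x => f x * X g x) (fun s => secZ f (D s)) =
    fn C U f * ati U X D;
  res_ati : forall U V X D, open U -> open V -> V `<=` U -> atiyah U X D ->
    res V (ati U X D) = ati V X D;
  pb_sec_sec : forall U s t, open U -> smooth_sec U s -> smooth_sec U t ->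
    pb S (sec U s) (sec U t) = fn C U (fun x => ip (s x) (t x));
  pb_ati_fn : forall U X D f, open U -> atiyah U X D -> smooth_on U f ->
    pb S (ati U X D) (fn C U f) = fn C U (X f);
  pb_ati_sec : forall U X D s, open U -> atiyah U X D -> smooth_sec U s ->
    pb S (ati U X D) (sec U s) = sec U (D s);
  pb_ati_ati : forall U X X' D D', open U ->
    atiyah U X D -> atiyah U X' D' ->
    pb S (ati U X D) (ati U X' D') =
    ati U (fun f x => X (X' f) x - X' (X f) x)
          (fun s x => D (D' s) x - D' (D s) x) }.
Arguments sec {R M C S E} c U s.
Arguments ati {R M C S E} c U X D.

Section Lagrangian.
Context {R : realType} {M : manifold R} (E : pe_bundle M).
Variables (N : set M) (K : forall x, set (E x)).

(* K -> N is a subbundle of rank q of E restricted to N: it has local frames;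
   smooth sections of E over the embedded N are the local restrictions of
   smooth sections of E. *)
Definition subbundle (q : nat) : Prop :=
  forall x, N x -> exists (U : set M) (k : 'I_q -> section E),
  [/\ open U, U x, (forall i, smooth_sec U (k i)) &
    forall y, U y -> N y ->
      (forall a : 'I_q -> R, \sum_i a i *: k i y = 0 -> forall i, a i = 0) /\
      (forall u, K u <-> exists a : 'I_q -> R, u = \sum_i a i *: k i y)].

Definition lagrangian_subbundle (q : nat) : Prop :=
  subbundle q /\
  forall x, N x -> forall u : E x, K u <-> forall v, K v -> ip u v = 0.

Definition section_in (U : set M) (s : section E) : Prop :=
  smooth_sec U s /\ forall x, U x -> N x -> K (s x).

Context {C : Nmanifold2 M} {S : symplectic C} (P : corresponds S E) (d : nat).

Inductive ideal_gen (V : set M) : C V -> Prop :=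
| Ideal0 f of smooth_on V f & (forall x, V x -> N x -> f x = 0) :
    ideal_gen (fn C V f)
| Ideal1 s of section_in V s : ideal_gen (sec P V s)
| Ideal2 X D of atiyah V X D &
    (forall x, V x -> N x -> tangent_to N d x (fun f => X f x)) &
    (forall W s, open W -> W `<=` V -> section_in W s -> section_in W (D s)) :
    ideal_gen (ati P V X D).

(* The sheaf of vanishing ideals. Membership has to be tested near the points
   of N only: off the closure of N, the unit is one of the generators, and for
   N closed this is the sheaf of ideals generated by ideal_gen. If N is not
   closed, no condition is imposed at the other points of its closure. *)
Definition vanishing_ideal (U : set M) (a : C U) : Prop :=
  forall x, U x -> N x -> exists V : set M,
  [/\ open V, V x, V `<=` U & exists n (b g : 'I_n -> C V),
    (forall i, ideal_gen (g i)) /\ res V a = \sum_i b i * g i].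

Definition reducible (Theta : C setT) : Prop :=
  forall U (a : C U), open U -> vanishing_ideal a ->
    vanishing_ideal (pb S (res U Theta) a).

End Lagrangian.

Section Courant.
Context {R : realType} {M : manifold R} {C : Nmanifold2 M} {E : pe_bundle M}.
Variables (S : symplectic C) (P : corresponds S E).

Definition Courant_function (Theta : C setT) : Prop :=
  hdeg 3 Theta /\ pb S Theta Theta = 0.

(* rho and br are the anchor and bracket on Gamma(E) given by Theta through
   derived brackets *)
Definition Courant_structure_of (Theta : C setT)
    (rho : forall x, E x -> (M -> R) -> R)
    (br : section E -> section E -> section E) : Prop :=
  [/\ bundle_map_TM rho,
      (forall e f, smooth_sec setT e -> smooth_on setT f ->
         fn C setT (fun x => rho x (e x) f) =
         pb S (pb S Theta (sec P setT e)) (fn C setT f)),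
      (forall e1 e2, smooth_sec setT e1 -> smooth_sec setT e2 ->
         smooth_sec setT (br e1 e2))
    & (forall e1 e2, smooth_sec setT e1 -> smooth_sec setT e2 ->
         sec P setT (br e1 e2) =
         pb S (pb S Theta (sec P setT e1)) (sec P setT e2))].

End Courant.

(* Main.v *)
(* Near a point of N choose sections k_i framing K along N, sections l_j with
   <k_i, l_j> = delta_ij, slice coordinates y_a cutting out N, and elements Q_a
   of degree 2 with {Q_a, y_b} = delta_ab; the latter exist because the bracket
   is non-degenerate.  Modulo the vanishing ideal I, every element of degree 3
   is then a polynomial sum_a u_a Q_a + F, with u_a linear and F cubic in the
   l_j.  Bracketing with y_b recovers u_b, and bracketing three times with the
   k_i recovers F, by Euler's identity sum_m l_m {k_m, F} = 3 F.  So an element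
   of degree 3 lies in I as soon as its brackets with the y_b and its iterated
   brackets with the k_i do.

   If rho(K) is tangent to N and K is closed under the Courant bracket, the
   derived bracket formulas put {Theta, f} and {Theta, s} in I for f in I_0 and
   s in I_1, and by the Jacobi identity {Theta, h} satisfies the criterion above
   for h in I_2.  Conversely, I is stable under brackets with I_0 and I_1, so
   reducibility puts {{Theta, s}, f} and {{Theta, s}, t} in I, and the elements
   of degree 0 and 1 of I are those of I_0 and I_1.  As the anchor and the
   Courant bracket are given on global sections, cut-off functions are used to
   pass between local and global objects. *)
Require Import Defs.
From mathcomp Require Import all_boot all_order all_algebra.
From mathcomp Require Import all_classical all_reals all_analysis.
From mathcomp Require Import ring lra.

Set Implicit Arguments.
Unset Strict Implicit.
Unset Printing Implicit Defensive.

Import Order.TTheory GRing.Theory Num.Theory.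
Import numFieldNormedType.Exports.

Local Open Scope classical_set_scope.
Local Open Scope ring_scope.

(** * Directional derivatives *)

Section LineDerivatives.
Context {R : realType} {n : nat}.
Implicit Types (F : 'rV[R]_n -> R) (U : set 'rV[R]_n).

(** The generators of I stop at degree 2, where membership can be read off a function, a section or
    an operator. For h in I_2 the bracket {Theta, h} has degree 3, where no such reading exists;
    adapted frames remove this obstacle by replacing membership with conditions on brackets of lower
    degree. Coordinates of C enter only twice: to produce the Q_a from non-degeneracy, and to write
    an element of degree 3 as a sum of products of degrees 1 and 2. After that, factors of degree 1
    are reduced by K = K^perp, and factors of degree 2 by viewing them as operators on sections.
    Membership is local near N, so each argument may shrink the open set, and the open set obtained
    may depend on the generator treated. Since smoothness is given through directional derivatives
    alone, linearity in the direction, the chain rule and cut-off functions have to be derived. *)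

Lemma derive_line F (a v : 'rV[R]_n) (h t : R) :
  derivable F (a + (t * h) *: v) v ->
  is_derive t 1 (fun t => F (a + (t * h) *: v)) (h * 'D_v F (a + (t * h) *: v)).
Proof.
move=> dF.
have d1 : is_derive (t * h) 1 (fun s => F (a + s *: v))
    ('D_v F (a + (t * h) *: v)).
  set g2 := fun k : R => k^-1 *: ((F \o shift (a + (t * h) *: v)) (k *: v) -
                          F (a + (t * h) *: v)).
  have E (k : R) : k^-1 *: (((fun s => F (a + s *: v)) \o shift (t * h))
                 (k *: (1 : R)) - F (a + (t * h) *: v)) = g2 k.
    rewrite /g2 /=; congr (_ *: (F _ - _)).
    by rewrite [k%:A]mulr1 scalerDl addrCA.
  split; rewrite /derivable /derive; set g1 := fun k => _;
    by rewrite (_ : g1 = g2) //; apply/funext => k; rewrite -E.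
have d2 : is_derive t 1 (fun t => t * h) h.
  rewrite (_ : (fun t => t * h) = id * cst h); last exact/funext.
  by apply: is_derive_eq; rewrite scaler0 add0r [_%:A]mulr1.
rewrite mulrC.
exact: (@is_derive1_comp R (fun s => F (a + s *: v)) (fun t => t * h) _ _ _ d1 d2).
Qed.

(** The parameter runs over [0, 1] and [h] is kept as a factor of the direction, so that the sign of
    [h] requires no case distinction. *)
Lemma MVT_line F (a v : 'rV[R]_n) (h : R) :
  (forall t, 0 <= t <= 1 -> derivable F (a + (t * h) *: v) v) ->
  exists2 c, 0 <= c <= 1 & F (a + h *: v) - F a = h * 'D_v F (a + (c * h) *: v).
Proof.
move=> dF.
have [||c c01] := @MVT_segment R (fun t => F (a + (t * h) *: v))
  (fun t => h * 'D_v F (a + (t * h) *: v)) 0 1 ler01.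
- move=> t; rewrite in_itv /= => /andP[t0 t1]; apply: derive_line.
  by apply: dF; rewrite !ltW.
- apply: derivable_within_continuous => t; rewrite in_itv /= => t01.
  by have [] := derive_line (dF _ t01).
rewrite mul1r mul0r scale0r addr0 subr0 mulr1 => ->.
by exists c => //; move: c01; rewrite in_itv.
Qed.


(** Only continuity of each directional derivative is asked for; additivity in the direction is a
    consequence ([derive_add]). *)
Definition C1 U F := forall v : 'rV[R]_n,
  (forall x, U x -> derivable F x v) /\
  (forall x, U x -> {for x, continuous (fun y => 'D_v F y)}).

(* The increment of F from y + h u to y + h u + h v is h D_v F at a nearby
   point, and D_v F is continuous. *)
Lemma derive_add U F (u v y : 'rV[R]_n) : open U -> C1 U F -> U y ->
  'D_(u + v) F y = 'D_u F y + 'D_v F y.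
Proof.
move=> oU cF Uy.
have [du _] := cF u; have [dv cv] := cF v.
rewrite [LHS]/derive; apply: cvg_lim => //.
have H1 : (fun h => h^-1 *: ((F \o shift y) (h *: u) - F y)) @ 0^' --> 'D_u F y.
  exact: du.
have H2 : (fun h => h^-1 *: (F (h *: (u + v) + y) - F (h *: u + y))) @ 0^'
    --> 'D_v F y.
  apply/cvgrPdist_lt => e e0.
  have [r r0 Hr] : exists2 r, 0 < r & forall z, `|y - z| < r -> U z /\
      `|'D_v F y - 'D_v F z| < e.
    have A1 : nbhs y U by exact: open_nbhs_nbhs.
    have A2 : \forall z \near y, `|'D_v F y - 'D_v F z| < e.
      by have /cvgrPdist_lt := cv y Uy; apply.
    have [r r0 Hr] := (nbhs_ballP _ _).1 (filterI A1 A2).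
    by exists r => // z yz; apply: Hr; rewrite -ball_normE.
  (* The summand 1 keeps the denominator positive when u = v = 0. *)
  have s0 : 0 < r / (`|u| + `|v| + 1).
    by rewrite divr_gt0// ltr_pwDr// addr_ge0.
  near=> h.
  have h0 : h != 0 by near: h; exact: nbhs_dnbhs_neq.
  have hs : `|h| * (`|u| + `|v| + 1) < r.
    by rewrite -ltr_pdivlMr ?ltr_pwDr ?addr_ge0//; near: h; exact: dnbhs0_lt.
  have near_y t : 0 <= t <= 1 -> `|y - (y + h *: u + (t * h) *: v)| < r.
    case/andP=> t0 t1; apply: le_lt_trans hs.
    rewrite -addrA opprD addNKr normrN (le_trans (ler_normD _ _))//.
    rewrite !normrZ !mulrDr mulr1 -addrA lerD2l (ger0_norm t0).
    apply: (@le_trans _ _ (`|h| * `|v|)); last by rewrite lerDl.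
    by rewrite ler_wpM2r// ler_piMl.
  have [t /near_y/Hr[_ +]] := @MVT_line F (y + h *: u) v h
    (fun t t01 => dv _ (Hr _ (near_y t t01)).1).
  have -> : h *: (u + v) + y = y + h *: u + h *: v.
    by rewrite scalerDr addrAC (addrC _ y).
  move=> + eqt; rewrite (addrC (h *: u)) eqt.
  by rewrite scalerA mulVf// scale1r.
apply: cvg_trans (cvgD H1 H2); apply: near_eq_cvg; near=> h => /=.
by rewrite -[LHS]scalerDr; congr (_ *: _); rewrite addrC subrKA.
Unshelve. all: by end_near. Qed.

Lemma derive_scale F (a : R) (v y : 'rV[R]_n) : derivable F y v ->
  'D_(a *: v) F y = a * 'D_v F y.
Proof.
move=> dF.
have := @derive_line F y v a 0; rewrite mul0r scale0r addr0 => /(_ dF)[_ <-].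
rewrite /derive; apply: (congr1 (fun f => lim (f @ 0^'))); apply/funext => k /=.
by rewrite mul0r scale0r !addr0 [k%:A]mulr1 scalerA (addrC y).
Qed.

Lemma derive_rowE U F (v y : 'rV[R]_n) : open U -> C1 U F -> U y ->
  'D_v F y = \sum_j v ord0 j * 'D_(delta_mx 0 j) F y.
Proof.
move=> oU cF Uy; rewrite {1}(row_sum_delta v).
elim/big_rec2: _ => [|j y1 y2 _ <-]; first by rewrite derive0.
rewrite (derive_add _ _ oU) // derive_scale //.
by have [+ _] := cF (delta_mx 0 j); apply.
Qed.

(** The curve h |-> phi (p + h v) follows no line. Writing phi (p + h v) = phi p + h u(h), with u(h)
    tending to the derivative of [phi], the mean value theorem applies to [F] along u(h); the limit
    is taken in the expansion over the standard basis, whose terms are continuous at phi p. *)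
Lemma is_derive_chain m U F (phi : 'rV[R]_m -> 'rV[R]_n) (p v : 'rV[R]_m) :
  open U -> C1 U F -> U (phi p) ->
  (forall j, derivable (fun y => phi y ord0 j) p v) ->
  is_derive p v (F \o phi) ('D_(\row_j 'D_v (fun y => phi y ord0 j) p) F (phi p)).
Proof.
move=> oU cF Up dphi.
have dphi' : derivable phi p v by apply/derivable_mxP => i j; rewrite ord1.
set w := \row_j _.
have ew : w = 'D_v phi p.
  by rewrite derive_mx //; apply/rowP => j; rewrite !mxE.
pose u (h : R) := h^-1 *: (phi (h *: v + p) - phi p).
have uw : u h @[h --> 0^'] --> w by rewrite ew; exact: dphi'.
have cphi : phi (h *: v + p) @[h --> 0^'] --> phi p.
  have c0 : phi p + h *: u h @[h --> 0^'] --> phi p + (0 : R) *: w.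
    apply: cvgD; first exact: cvg_cst.
    by apply: cvgZ => //; apply: nbhs_dnbhs.
  rewrite scale0r addr0 in c0; apply: cvg_trans c0.
  apply: near_eq_cvg; near=> h.
  have h0 : h != 0 by near: h; exact: nbhs_dnbhs_neq.
  by rewrite /u scalerA mulfV// scale1r [LHS]addrC subrK.
have [r r0 Hr] : exists2 r, 0 < r & forall z, `|phi p - z| < r -> U z.
  have [r r0 Hr] := (nbhs_ballP _ _).1 (open_nbhs_nbhs (conj oU Up)).
  by exists r => // z yz; apply: Hr; rewrite -ball_normE.
(* The conditions on [h] sit inside the existential so that choice yields a total function; where
   they fail, 0 serves as a dummy value. *)
have Z (h : R) : exists z, h != 0 -> `|phi p - phi (h *: v + p)| < r ->
    `|phi p - z| <= `|phi p - phi (h *: v + p)| /\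
    h^-1 *: (F (phi (h *: v + p)) - F (phi p)) =
    \sum_j u h ord0 j * 'D_(delta_mx 0 j) F z.
  have [->|h0] := eqVneq h 0; first by exists 0.
  have [hr|_] := ltP `|phi p - phi (h *: v + p)| r; last by exists 0.
  have huE : phi (h *: v + p) = phi p + h *: u h.
    by rewrite /u scalerA mulfV// scale1r [RHS]addrC subrK.
  have bound t : 0 <= t <= 1 -> `|phi p - (phi p + (t * h) *: u h)|
      <= `|phi p - phi (h *: v + p)|.
    case/andP=> t0 t1.
    rewrite huE !opprD !addNKr !normrN -scalerA [leLHS]normrZ (ger0_norm t0).
    by rewrite ler_piMl.
  have UU t : 0 <= t <= 1 -> U (phi p + (t * h) *: u h).
    by move=> t01; apply: Hr; exact: le_lt_trans (bound t t01) hr.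
  have [t t01] := @MVT_line F (phi p) (u h) h
    (fun t t01 => (cF (u h)).1 _ (UU t t01)).
  rewrite -huE => E.
  exists (phi p + (t * h) *: u h) => _ _; split; first exact: bound.
  by rewrite E -(derive_rowE _ oU cF (UU t t01)) scalerA mulVf// scale1r.
have /choice[z Hz] := Z.
have zp : z h @[h --> 0^'] --> phi p.
  apply/cvgrPdist_lt => e e0; near=> h.
  have hr : `|phi p - phi (h *: v + p)| < r.
    by near: h; move/cvgrPdist_lt : cphi; apply.
  have h0 : h != 0 by near: h; exact: nbhs_dnbhs_neq.
  have [+ _] := Hz h h0 hr; move=> /le_lt_trans; apply.
  by near: h; move/cvgrPdist_lt : cphi; apply.
have key : (fun h => h^-1 *: ((F \o phi \o shift p) (h *: v) - (F \o phi) p))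
    @ 0^' --> 'D_w F (phi p).
  rewrite (derive_rowE _ oU cF Up).
  have S : \sum_j u h ord0 j * 'D_(delta_mx 0 j) F (z h) @[h --> 0^'] -->
      \sum_j w ord0 j * 'D_(delta_mx 0 j) F (phi p).
    apply: cvg_big => // [|j _]; first exact: add_continuous.
    apply: cvgM.
      apply: (@cvg_comp _ _ _ u (fun M : 'rV[R]_n => M ord0 j : R) _ _ _ uw).
      exact: coord_continuous.
    apply: (@cvg_comp _ _ _ z (fun x => 'D_(delta_mx 0 j) F x) _ _ _ zp).
    exact: (cF _).2.
  apply: cvg_trans S; apply: near_eq_cvg; near=> h => /=.
  have hr : `|phi p - phi (h *: v + p)| < r.
    by near: h; move/cvgrPdist_lt : cphi; apply.
  have h0 : h != 0 by near: h; exact: nbhs_dnbhs_neq.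
  by have [_ ->] := Hz h h0 hr.
split; first by apply/cvg_ex; exists ('D_w F (phi p)).
exact: cvg_lim key.
Unshelve. all: by end_near. Qed.

End LineDerivatives.

(** * Stability of C^k functions under algebraic operations *)

Section CkTheory.
Context {R : realType} {n : nat}.
Implicit Types (f g : 'rV[R]_n -> R) (U V : set 'rV[R]_n) (k : nat).

Lemma near_open_eq U f g (x : 'rV[R]_n) : open U -> U x ->
  (forall y, U y -> f y = g y) -> \forall y \near x, f y = g y.
Proof. by move=> oU Ux fg; apply: filterS (open_nbhs_nbhs (conj oU Ux)). Qed.

Lemma continuous_open_congr U f g (x : 'rV[R]_n) : open U ->
  (forall y, U y -> f y = g y) -> U x ->
  {for x, continuous f} -> {for x, continuous g}.
Proof.
move=> oU fg Ux; have E := near_open_eq oU Ux fg.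
rewrite /prop_for /continuous_at -(fg x Ux) => cf.
by apply: cvg_trans cf; apply: near_eq_cvg E.
Qed.

Lemma Ck_congr U f g k : open U -> (forall y, U y -> f y = g y) ->
  Ck k U f -> Ck k U g.
Proof.
move=> oU; elim: k f g => [|k IH] f g fg [cf df]; split.
- by move=> x Ux; apply: (continuous_open_congr oU fg Ux); exact: cf.
- by [].
- by move=> x Ux; apply: (continuous_open_congr oU fg Ux); exact: cf.
- move=> v; have [dv cv] := df v; split.
    by move=> x Ux; apply: near_eq_derivable (dv x Ux); exact: near_open_eq fg.
  by apply: IH cv => y Uy; apply: near_eq_derive; exact: near_open_eq fg.
Qed.

Lemma Ck_sub U V f k : V `<=` U -> Ck k U f -> Ck k V f.
Proof.
move=> VU; elim: k f => [|k IH] f [cf df]; split => //.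
- by move=> x /VU; exact: cf.
- by move=> x /VU; exact: cf.
- move=> v; have [dv cv] := df v; split; last exact: IH.
  by move=> x /VU; exact: dv.
Qed.

Lemma Ck_local U f k :
  (forall x, U x -> exists2 V, V x & Ck k V f) -> Ck k U f.
Proof.
elim: k f => [|k IH] f loc; split => //.
- by move=> x /loc[V Vx [cf _]]; exact: cf.
- by move=> x /loc[V Vx [cf _]]; exact: cf.
- move=> v; split; first by move=> x /loc[V Vx [_ /(_ v)[+ _]]]; apply.
  by apply: IH => x /loc[V Vx [_ /(_ v)[_ cv]]]; exists V.
Qed.

Lemma CkW U f k : Ck k.+1 U f -> Ck k U f.
Proof.
elim: k f => [|k IH] f [cf df]; split => // v.
by have [dv cv] := df v; split => //; exact: IH.
Qed.

Lemma Ck_cst U (a : R) k : Ck k U (fun=> a).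
Proof.
elim: k a => [|k IH] a; split => //; try by move=> x _; exact: cst_continuous.
move=> v; split; first by move=> x _; exact: derivable_cst.
have -> : (fun x : 'rV[R]_n => 'D_v (fun=> a) x) = fun=> 0.
  by apply/funext => x; exact: derive_cst.
exact: IH.
Qed.

Lemma CkD U f g k : open U -> Ck k U f -> Ck k U g ->
  Ck k U (fun x => f x + g x).
Proof.
move=> oU; elim: k f g => [|k IH] f g [cf df] [cg dg]; split => //;
  try by move=> x Ux; apply: continuousD; [exact: cf|exact: cg].
move=> v; have [dfv cfv] := df v; have [dgv cgv] := dg v; split.
  by move=> x Ux; apply: derivableD; [exact: dfv|exact: dgv].
apply: Ck_congr (IH _ _ cfv cgv) => // x Ux.
by rewrite -deriveD //; [exact: dfv|exact: dgv].
Qed.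

Lemma CkM U f g k : open U -> Ck k U f -> Ck k U g ->
  Ck k U (fun x => f x * g x).
Proof.
move=> oU; elim: k f g => [|k IH] f g hf hg.
  case: hf hg => cf _ [cg _]; split => // x Ux.
  by apply: continuousM; [exact: cf|exact: cg].
have [f0 g0] := (CkW hf, CkW hg); case: hf hg => cf df [cg dg]; split.
  by move=> x Ux; apply: continuousM; [exact: cf|exact: cg].
move=> v; have [dfv cfv] := df v; have [dgv cgv] := dg v; split.
  by move=> x Ux; apply: derivableM; [exact: dfv|exact: dgv].
apply: Ck_congr (CkD oU (IH _ _ f0 cgv) (IH _ _ g0 cfv)) => // x Ux.
by rewrite deriveM //; [exact: dfv|exact: dgv].
Qed.

Lemma CkV U f k : open U -> (forall x, U x -> f x != 0) -> Ck k U f ->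
  Ck k U (fun x => (f x)^-1).
Proof.
move=> oU f0; elim: k => [|k IH] hf.
  by case: hf => cf _; split => // x Ux; apply: continuousV; [exact: f0|exact: cf].
have IH' := IH (CkW hf); case: hf => cf df; split.
  by move=> x Ux; apply: continuousV; [exact: f0|exact: cf].
move=> v; have [dfv cfv] := df v; split.
  by move=> x Ux; apply: derivableV; [exact: f0|exact: dfv].
have := CkM oU (CkM oU (CkM oU IH' IH') cfv) (Ck_cst U (-1) k).
apply: Ck_congr => // x Ux.
rewrite deriveV ?f0 //; last exact: dfv.
by rewrite mulrN1 -exprVn expr2 -mulNr.
Qed.

Lemma Ck_C1 U f k : Ck k.+2 U f -> C1 U f.
Proof. by case=> _ df v; have [dv [cv _]] := df v. Qed.

End CkTheory.

(** * Smooth functions vanishing to infinite order at 0 *)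

Section FlatFunction.
Context {R : realType}.

(* Derivatives of flat m are combinations of flat m.+1 and flat m.+2, which
   makes smoothness an induction over the whole family. *)
Definition flat (m : nat) (t : R) : R :=
  if 0 < t then t^-1 ^+ m * expR (- t^-1) else 0.

(** With s = 1/t, exp s = exp (s/(m+1))^(m+1) is at least (s/(m+1))^(m+1), whence s^m exp (-s) <=
    (m+1)^(m+1) / s. *)
Lemma flat_le (m : nat) (t : R) : `|flat m t| <= m.+1%:R ^+ m.+1 * `|t|.
Proof.
rewrite /flat; case: ltP => [t0|_]; last first.
  by rewrite normr0 mulr_ge0 // exprn_ge0.
have s0 : 0 < t^-1 by rewrite invr_gt0.
rewrite ger0_norm ?mulr_ge0 ?expR_ge0 ?exprn_ge0 ?(ltW s0)// (ger0_norm (ltW t0)).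
rewrite -{3}(invrK t); set s := t^-1 in s0 *.
rewrite expRN ler_pdivrMr ?expR_gt0//.
rewrite mulrAC ler_pdivlMr// -exprSr.
have -> : expR s = expR (s / m.+1%:R) ^+ m.+1.
  by rewrite -expRM_natl mulrC divfK.
rewrite -exprMn lerXn2r ?nnegrE ?(ltW s0) ?mulr_ge0 ?expR_ge0//.
rewrite -ler_pdivrMl// mulrC; apply: le_trans (expR_ge1Dx _).
by rewrite lerDr.
Qed.

(** For t > 0 put s = 1/t: the derivative of s^m exp (-s) in s gets multiplied by ds/dt = -s^2,
    which leads to the exponents m+1 and m+2. *)
Lemma is_derive_flat (m : nat) (t : R) :
  is_derive t 1 (flat m) (flat m.+2 t - m%:R * flat m.+1 t).
Proof.
have [t0|t0|->] := ltgtP t 0.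
- have E : \forall y \near t, cst 0 y = flat m y.
    near=> y; rewrite /flat ltNge ltW//; near: y; exact: lt_nbhsl.
  apply: (near_eq_is_derive E).
  by rewrite /flat ltNge (ltW t0) /= mulr0 subr0; exact: is_derive_cst.
- have E : \forall y \near t, y^-1 ^+ m * expR (- y^-1) = flat m y.
    by near=> y; rewrite /flat ifT//; near: y; exact: lt_nbhsr.
  apply: (near_eq_is_derive E).
  rewrite /flat t0.
  have tn0 : t != 0 by rewrite gt_eqF.
  have dV : is_derive t 1 (fun y : R => y^-1) (- t ^- 2).
    split; first exact: (derivableV tn0).
    have := @deriveV R R id t 1 tn0 (@derivable_id R R t 1).
    by rewrite derive_id => E1; apply: etrans E1 _; exact: mulr1.
  have dG (s : R) : is_derive s 1 (fun s : R => s ^+ m * expR (- s))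
      (m%:R * s ^+ m.-1 * expR (- s) - s ^+ m * expR (- s)).
    have d1 : is_derive s 1 (fun s : R => s ^+ m) (m%:R * s ^+ m.-1).
      split; first exact: exprn_derivable.
      by rewrite exp_derive; exact: mulr1.
    have d2 : is_derive s 1 (fun s : R => expR (- s)) (- expR (- s)).
      rewrite -mulrN1.
      exact: (@is_derive1_comp R expR -%R s _ _ (is_derive_expR _) _).
    have [dM vM] := @is_deriveM R R _ _ s 1 _ _ d1 d2.
    split; first exact: dM.
    by apply: etrans vM _; rewrite /GRing.scale /=; ring.
  have [dC vC] := is_derive1_comp (dG t^-1) dV.
  split; first exact: dC.
  apply: etrans vC _.
  rewrite -exprVn; case: (m) => [|k]; rewrite ?exprS; ring.
- have -> : flat m.+2 0 - m%:R * flat m.+1 0 = 0.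
    by rewrite /flat ltxx mulr0 subrr.
  have key : (fun h : R => h^-1 *: ((flat m \o shift 0) (h *: 1) - flat m 0))
      @ 0^' --> (0 : R).
    apply/cvgr0Pnorm_lt => e e0; near=> h.
    have h0 : h != 0 by near: h; exact: nbhs_dnbhs_neq.
    (* The difference quotient at 0 is the next member of the family, which [flat_le] sends to 0. *)
    have -> : h^-1 *: ((flat m \o shift 0) (h *: 1) - flat m 0) = flat m.+1 h.
      rewrite /= addr0 [_%:A]mulr1 /flat ltxx subr0; case: ifP => _.
        by rewrite exprS -mulrA.
      by rewrite scaler0.
    apply: le_lt_trans (flat_le _ _) _.
    rewrite -ltr_pdivlMl; last by rewrite exprn_gt0.
    near: h; apply: dnbhs0_lt; rewrite mulrC divr_gt0// exprn_gt0//.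
  split; first by apply/cvg_ex; exists 0.
  exact: cvg_lim key.
Unshelve. all: by end_near. Qed.

Lemma continuous_flat (m : nat) : continuous (flat m).
Proof.
move=> t; apply: differentiable_continuous; apply/derivable1_diffP.
by have [] := is_derive_flat m t.
Qed.

Lemma is_derive_flat_comp (n m : nat) (g : 'rV[R]_n -> R) (x v : 'rV[R]_n) :
  derivable g x v ->
  is_derive x v (flat m \o g)
    ((flat m.+2 (g x) - m%:R * flat m.+1 (g x)) * 'D_v g x).
Proof.
move=> dg.
pose G (h : R) := g (h *: v + x).
have E0 : G 0 = g x by rewrite /G scale0r add0r.
have shiftE (f : 'rV[R]_n -> R) : (fun h : R =>
    h^-1 *: (((fun h => f (h *: v + x)) \o shift 0) (h *: 1) - f (0 *: v + x)))
    = (fun h => h^-1 *: ((f \o shift x) (h *: v) - f x)).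
  by apply/funext => h /=; rewrite addr0 scale0r add0r [_%:A]mulr1.
have dG : is_derive (0 : R) (1 : R) G ('D_v g x).
  split; first exact: ((derivable1P g x v).1 dg).
  by rewrite /derive; apply: (congr1 (fun f => lim (f @ 0^'))); exact: shiftE.
have [] := is_derive1_comp (is_derive_flat m (G 0)) dG.
rewrite E0 => dflat vflat; split.
  exact: ((derivable1P (flat m \o g) x v).2 dflat).
rewrite -vflat /derive; apply: (congr1 (fun f => lim (f @ 0^'))).
by rewrite -(shiftE (flat m \o g)).
Qed.

Lemma Ck_flat (n k m : nat) (U : set 'rV[R]_n) (g : 'rV[R]_n -> R) :
  open U -> Ck k U g -> Ck k U (flat m \o g).
Proof.
move=> oU; elim: k m => [|k IH] m hg.
  case: hg => cg _; split => // x Ux.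
  by apply: continuous_comp; [exact: cg|exact: continuous_flat].
have g0 := CkW hg; case: hg => cg dg; split.
  by move=> x Ux; apply: continuous_comp; [exact: cg|exact: continuous_flat].
move=> v; have [dgv cgv] := dg v; split.
  by move=> x Ux; have [] := is_derive_flat_comp m (dgv x Ux).
have := CkM oU (CkD oU (IH m.+2 g0) (CkM oU (Ck_cst U (- m%:R) k) (IH m.+1 g0))) cgv.
apply: Ck_congr => // x Ux.
by have [_ ->] := is_derive_flat_comp m (dgv x Ux); rewrite /= mulNr.
Qed.

End FlatFunction.

(** * Smooth functions and cut-offs *)

Section ManifoldFunctions.
Context {R : realType} {M : manifold R}.
Implicit Types (f g : M -> R) (U V : set M) (c : chart R M (mdim M)).

Lemma chart_image_open c U : open U -> open (cmap c @` (U `&` cdom c)).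
Proof.
move=> oU; rewrite openE => _ [x [Ux cx] <-].
have ix : (cmap c @` cdom c) (cmap c x) by exists x.
have near1 : \forall y \near cmap c x, (cmap c @` cdom c) y.
  by apply: open_nbhs_nbhs; split => //; exact: cimg_open.
have near2 : \forall y \near cmap c x, U (cinv c y).
  apply: (cinv_cont ix); rewrite cmapK //; exact: open_nbhs_nbhs.
rewrite /interior; near=> y.
have [z cz zy] : (cmap c @` cdom c) y by near: y.
exists z => //; split => //; rewrite -(cmapK cz) zy; by near: y.
Unshelve. all: by end_near. Qed.

Lemma near_chart_image c U x : open U -> U x -> cdom c x ->
  \forall y \near cmap c x, (cmap c @` (U `&` cdom c)) y.
Proof.
move=> oU Ux cx; apply: open_nbhs_nbhs; split; first exact: chart_image_open.
by exists x.
Qed.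

Lemma smooth_on_congr U f g : open U -> (forall x, U x -> f x = g x) ->
  smooth_on U f -> smooth_on U g.
Proof.
move=> oU fg sf c ac k; apply: Ck_congr (sf c ac k).
  exact: chart_image_open.
by move=> _ [x [Ux cx] <-]; rewrite /= cmapK// fg.
Qed.

Lemma smooth_on_sub U V f : V `<=` U -> smooth_on U f -> smooth_on V f.
Proof.
move=> VU sf c ac k; apply: Ck_sub (sf c ac k).
by move=> _ [x [Vx cx] <-]; exists x => //; split => //; exact: VU.
Qed.

Lemma smooth_on_local U f :
  (forall x, U x -> exists2 V, V x & smooth_on V f) -> smooth_on U f.
Proof.
move=> loc c ac k; apply: Ck_local => _ [x [Ux cx] <-].
have [V Vx sf] := loc x Ux.
by exists (cmap c @` (V `&` cdom c)); [exists x|exact: sf].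
Qed.

Lemma smooth_on_cst U (a : R) : smooth_on U (fun=> a).
Proof. by move=> c ac k; exact: Ck_cst. Qed.

Lemma smooth_onD U f g : open U -> smooth_on U f -> smooth_on U g ->
  smooth_on U (fun x => f x + g x).
Proof.
move=> oU sf sg c ac k; apply: CkD (sf c ac k) (sg c ac k).
exact: chart_image_open.
Qed.

Lemma smooth_onM U f g : open U -> smooth_on U f -> smooth_on U g ->
  smooth_on U (fun x => f x * g x).
Proof.
move=> oU sf sg c ac k; apply: CkM (sf c ac k) (sg c ac k).
exact: chart_image_open.
Qed.

Lemma smooth_onN U f : open U -> smooth_on U f -> smooth_on U (fun x => - f x).
Proof.
move=> oU sf; apply: smooth_on_congr (smooth_onM oU (smooth_on_cst U (-1)) sf) => //.
by move=> x _; rewrite mulN1r.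
Qed.

Lemma smooth_onV U f : open U -> (forall x, U x -> f x != 0) ->
  smooth_on U f -> smooth_on U (fun x => (f x)^-1).
Proof.
move=> oU f0 sf c ac k; apply: CkV (sf c ac k); first exact: chart_image_open.
by move=> _ [x [Ux cx] <-]; rewrite /= cmapK// f0.
Qed.

Lemma smooth_on_sum U (I : Type) (r : seq I) (F : I -> M -> R) : open U ->
  (forall i, smooth_on U (F i)) -> smooth_on U (fun x => \sum_(i <- r) F i x).
Proof.
move=> oU sF; elim: r => [|i r IH].
  by apply: smooth_on_congr (smooth_on_cst U 0) => // x _; rewrite big_nil.
apply: smooth_on_congr (smooth_onD oU (sF i) IH) => // x _.
by rewrite big_cons.
Qed.

Lemma smooth_on_prod U (I : Type) (r : seq I) (F : I -> M -> R) : open U ->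
  (forall i, smooth_on U (F i)) -> smooth_on U (fun x => \prod_(i <- r) F i x).
Proof.
move=> oU sF; elim: r => [|i r IH].
  by apply: smooth_on_congr (smooth_on_cst U 1) => // x _; rewrite big_nil.
apply: smooth_on_congr (smooth_onM oU (sF i) IH) => // x _.
by rewrite big_cons.
Qed.

Lemma smooth_on_flat m U f : open U -> smooth_on U f -> smooth_on U (flat m \o f).
Proof. by move=> oU sf c ac k; apply: Ck_flat (sf c ac k); exact: chart_image_open. Qed.

Lemma smooth_on_coord c j : admissible c ->
  smooth_on (cdom c) (fun x => cmap c x ord0 j).
Proof. by move=> adm c' /adm[_ ts] k; rewrite setIC; exact: ts. Qed.

Lemma atlas_admissible c : atlas c -> admissible c.
Proof. by move=> ac c' ac'; split; apply: atlas_compat. Qed.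

Lemma smooth_continuous U f x : open U -> U x -> smooth_on U f ->
  {for x, continuous f}.
Proof.
move=> oU Ux sf; have [c ac cx] := atlas_cover x.
have [cf _] := sf c ac 0%N.
have cf1 : {for cmap c x, continuous (f \o cinv c)}.
  by apply: cf; exists x.
have cc := cmap_cont cx.
have E : \forall y \near x, (f \o cinv c \o cmap c) y = f y.
  have : \forall y \near x, cdom c y.
    by apply: open_nbhs_nbhs; split => //; exact: cdom_open.
  by apply: filterS => y cy; rewrite /= cmapK.
have cfc : {for x, continuous (f \o cinv c \o cmap c)}.
  exact: continuous_comp cc cf1.
rewrite /prop_for /continuous_at in cfc *.
rewrite -[in X in _ --> X](nbhs_singleton E).
by apply: cvg_trans cfc; apply: near_eq_cvg E.
Qed.

(** In a chart, [chi] is the quotient h1 / (h1 + h2) of flat functions of the squared distance [g]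
    to x, extended by 0. The box [S] is compact, hence closed because M is Hausdorff, so the
    extension is smooth. The open set [O], which covers M together with [V], lets functions on [V]
    be multiplied by [chi] and glued with 0. *)
Lemma exists_cutoff V (x : M) : open V -> V x ->
  exists (chi : M -> R) (O : set M), [/\ smooth_on setT chi,
    \forall y \near x, chi y = 1, open O,
    (forall y, O y -> chi y = 0) & (forall y, V y \/ O y)].
Proof.
move=> oV Vx; have [c ac cx] := atlas_cover x.
set p := cmap c x.
have [r r0 Hr] := (nbhs_ballP _ _).1 (near_chart_image oV Vx cx).
pose rho := r / 2.
have rho0 : 0 < rho by rewrite divr_gt0.
(* A product of segments, since its compactness is available coordinatewise; half of the radius [r]
   keeps it inside the open ball. *)
pose box := [set v : 'rV[R]_(mdim M) |
  forall i, v ord0 i \in `[p ord0 i - rho, p ord0 i + rho]].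
have box_img : box `<=` cmap c @` (V `&` cdom c).
  move=> v bv; apply: Hr; split => // i j; rewrite (ord1 i) /ball /=.
  have := bv j; rewrite in_itv /= => /andP[v1 v2].
  apply: (@le_lt_trans _ _ rho).
    by rewrite ler_norml; apply/andP; split; lra.
  by rewrite /rho ltr_pdivrMr// ltr_pMr// ltr1n.
pose S := cinv c @` box.
have SV y : S y -> V y /\ cdom c y.
  by move=> [v /box_img[z [Vz cz] <-] <-]; rewrite cmapK.
have cS : closed S.
  apply: compact_closed; first exact: mhausdorff.
  apply: continuous_compact; last first.
    exact: (@rV_compact R _ (fun i => `[p ord0 i - rho, p ord0 i + rho]%classic)
              (fun i => @segment_compact _ _ _)).
  apply: continuous_in_subspaceT => v; rewrite inE => /box_img[z [Vz cz] <-].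
  by apply: cinv_cont; exists z.
pose g (y : M) := \sum_j (cmap c y ord0 j - p ord0 j) ^+ 2.
(* g < a forces every coordinate within [rho] of [p], so [h1] vanishes outside the box. *)
pose a := rho ^+ 2.
have a0 : 0 < a by rewrite exprn_gt0.
have sg : smooth_on (cdom c) g.
  apply: smooth_on_sum => [|j]; first exact: cdom_open.
  have sj : smooth_on (cdom c) (fun y => cmap c y ord0 j + - p ord0 j).
    apply: smooth_onD; first exact: cdom_open.
      exact: smooth_on_coord (atlas_admissible ac).
    exact: smooth_on_cst.
  apply: smooth_on_congr (smooth_onM (@cdom_open _ _ _ c) sj sj); last by [].
  exact: cdom_open.
pose h1 y := flat 0 (a - g y).
pose h2 y := flat 0 (g y - a / 4).
have flat0_gt (t : R) : 0 < t -> 0 < flat 0 t.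
  by move=> t0; rewrite /flat t0 expr0 mul1r expR_gt0.
have flat0_eq (t : R) : t <= 0 -> flat 0 t = 0.
  by move=> t0; rewrite /flat ltNge t0.
have flat0_ge (t : R) : 0 <= flat 0 t.
  by case: (ltP 0 t) => [/flat0_gt/ltW//|/flat0_eq->].
(* Either g < a and the first term is positive, or g >= a > a/4 and the second is. *)
have den y : h1 y + h2 y != 0.
  rewrite gt_eqF // /h1 /h2; case: (ltP (g y) a) => ga.
    by rewrite ltr_pwDl// flat0_gt// subr_gt0.
  by rewrite ltr_wpDl// flat0_gt//; lra.
(* Defined by membership in [S] because [cmap] carries no information off the chart; [chiE] shows
   that the quotient formula holds on the whole chart. *)
pose chi y := if `[< S y >] then h1 y / (h1 y + h2 y) else 0.
have chiE y : cdom c y -> chi y = h1 y / (h1 y + h2 y).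
  rewrite /chi; case: asboolP => // nS cy.
  rewrite [h1 y]flat0_eq ?mul0r // subr_le0 leNgt; apply/negP => ga.
  apply: nS; exists (cmap c y); last by rewrite cmapK.
  move=> i.
  have : (cmap c y ord0 i - p ord0 i) ^+ 2 <= rho ^+ 2.
    apply: le_trans (ltW ga); rewrite /g (bigD1 i) //= lerDl.
    by apply: sumr_ge0 => j _; exact: sqr_ge0.
  rewrite -(real_normK (num_real (_ - _))) ler_sqr ?nnegrE ?(ltW rho0)//.
  rewrite in_itv /= ler_norml.
  by move=> /andP[e1 e2]; apply/andP; split; lra.
exists chi, (~` S); split.
- apply: smooth_on_local => y _; case: (pselect (S y)) => Sy.
    exists (cdom c); first by have [] := SV y Sy.
    have oc := @cdom_open _ _ _ c.
    have s1 : smooth_on (cdom c) h1.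
      apply: (@smooth_on_flat 0 (cdom c) (fun y => a - g y)) => //.
      apply: (smooth_onD oc) => //; first exact: smooth_on_cst.
      exact: smooth_onN.
    have s2 : smooth_on (cdom c) h2.
      apply: (@smooth_on_flat 0 (cdom c) (fun y => g y - a / 4)) => //.
      by apply: (smooth_onD oc) => //; exact: smooth_on_cst.
    have s3 := smooth_onM oc s1
      (smooth_onV oc (fun y _ => den y) (smooth_onD oc s1 s2)).
    by apply: (smooth_on_congr oc) s3 => z cz; rewrite chiE.
  exists (~` S) => //; apply: smooth_on_congr (smooth_on_cst _ 0).
    exact: closed_openC.
  by move=> z nS; rewrite /chi asboolF.
- have gx : g x = 0.
    by rewrite /g big1// => j _; rewrite subrr expr0n.
  have cg : {for x, continuous g}.
    by apply: smooth_continuous cx sg; exact: cdom_open.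
  have N1 : \forall y \near x, `|g x - g y| < a / 4.
    by move/cvgrPdist_lt : cg; apply; rewrite divr_gt0.
  have N2 : \forall y \near x, cdom c y.
    by apply: open_nbhs_nbhs; split => //; exact: cdom_open.
  near=> y.
  have cy : cdom c y by near: y.
  have gy : `|g x - g y| < a / 4 by near: y.
  rewrite chiE //; have -> : h2 y = 0.
    by apply: flat0_eq; move: gy; rewrite gx sub0r normrN => /ltr_normlW; lra.
  have := den y.
  have -> : h2 y = 0.
    by apply: flat0_eq; move: gy; rewrite gx sub0r normrN => /ltr_normlW; lra.
  by rewrite addr0 => d0; rewrite divff.
- exact: closed_openC.
- by move=> y nS; rewrite /chi asboolF.
- by move=> y; case: (pselect (S y)) => [/SV[]|]; [left|right].
Unshelve. all: by end_near. Qed.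

Lemma smooth_on_extend V O chi f : open V -> open O ->
  smooth_on setT chi -> (forall y, O y -> chi y = 0) ->
  (forall y, V y \/ O y) -> smooth_on V f ->
  smooth_on setT (fun y => chi y * f y).
Proof.
move=> oV oO schi chi0 VO sf; apply: smooth_on_local => y _.
case: (VO y) => [Vy|Oy].
  exists V => //; apply: smooth_onM => //.
  exact: smooth_on_sub schi.
exists O => //; apply: smooth_on_congr (smooth_on_cst O 0) => // z Oz.
by rewrite chi0// mul0r.
Qed.

End ManifoldFunctions.

(** * Tangent vectors *)

Section TangentVectors.
Context {R : realType} {M : manifold R}.
Implicit Types (f : M -> R) (U V N : set M) (c : chart R M (mdim M)).

Lemma is_derive_coord n (p w : 'rV[R]_n) j :
  is_derive p w (fun y : 'rV[R]_n => y ord0 j) (w ord0 j).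
Proof.
have did := @derivable_id R 'rV[R]_n p w.
split; first by have /derivable_mxP := did; apply.
by rewrite -[in RHS](derive_id p w) derive_mx // mxE.
Qed.

Lemma smooth_on_C1 U f c : atlas c -> smooth_on U f ->
  C1 (cmap c @` (U `&` cdom c)) (f \o cinv c).
Proof. by move=> ac sf; apply: (@Ck_C1 _ _ _ _ 0); exact: sf. Qed.

Lemma transition_C1 c c' j : transition_smooth c c' ->
  C1 (cmap c @` (cdom c `&` cdom c')) (fun y => cmap c' (cinv c y) ord0 j).
Proof. by move=> ts; apply: (@Ck_C1 _ _ _ _ 0); exact: ts. Qed.

Lemma transition_open c c' : open (cmap c @` (cdom c `&` cdom c')).
Proof. by rewrite setIC; apply: chart_image_open; exact: cdom_open. Qed.

(** The functions are known to be smooth in atlas charts only, so the derivative in [c'] is computed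
    as that of (f o cinv c) o phi, where [phi] changes coordinates from [c'] to [c]. *)
Lemma directional_transfer c c' (x : M) w v : atlas c -> admissible c' ->
  cdom c x -> cdom c' x -> directional c x w v ->
  directional c' x (\row_j v (fun y => cmap c' y ord0 j)) v.
Proof.
move=> ac adm' cx cx' dir U f oU Ux sf.
rewrite (dir U f oU Ux sf).
have [ts' ts] := adm' c ac.
pose psi y := cmap c' (cinv c y).
pose phi y := cmap c (cinv c' y).
have Ppsi : (cmap c @` (cdom c `&` cdom c')) (cmap c x) by exists x.
have Pphi : (cmap c' @` (cdom c' `&` cdom c)) (cmap c' x) by exists x.
have psix : psi (cmap c x) = cmap c' x by rewrite /psi cmapK.
have phix : phi (cmap c' x) = cmap c x by rewrite /phi cmapK.
set w' := \row_j _.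
have ew' : w' = \row_j 'D_w (fun y => psi y ord0 j) (cmap c x).
  apply/rowP => j; rewrite !mxE.
  by rewrite (dir _ _ (@cdom_open _ _ _ c') cx' (smooth_on_coord j adm')).
have dpsi j : derivable (fun y => psi y ord0 j) (cmap c x) w.
  by have [+ _] := transition_C1 j ts w; apply.
have dphi j : derivable (fun y => phi y ord0 j) (cmap c' x) w'.
  by have [+ _] := transition_C1 j ts' w'; apply.
(* [phi] and [psi] are mutually inverse, so the derivative of [phi] carries w' back to w. *)
have ew : \row_j 'D_w' (fun y => phi y ord0 j) (cmap c' x) = w.
  apply/rowP => j; rewrite mxE.
  have Up : (cmap c' @` (cdom c' `&` cdom c)) (psi (cmap c x)) by rewrite psix.
  have [_] := is_derive_chain (@transition_open c' c) (transition_C1 j ts') Up dpsi.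
  rewrite -ew' psix => <-.
  have [_ <-] := is_derive_coord (cmap c x) w j.
  apply: near_eq_derive.
  have := open_nbhs_nbhs (conj (@transition_open c c') Ppsi).
  apply: filterS => _ [z [cz cz'] <-] /=.
  by rewrite /psi cmapK // cmapK.
have Up : (cmap c @` (U `&` cdom c)) (phi (cmap c' x)).
  by rewrite phix; exists x.
have [_] := is_derive_chain (@chart_image_open _ _ c _ oU) (smooth_on_C1 ac sf) Up dphi.
rewrite ew phix => <-.
apply: near_eq_derive.
have := open_nbhs_nbhs (conj (@transition_open c' c) Pphi).
by apply: filterS => _ [z [cz cz'] <-] /=; rewrite /phi cmapK // cmapK.
Qed.

(** The components of a tangent vector in an admissible chart are its values on the coordinate
    functions, so tangency need only be tested on the equations of N. *)
Lemma tangent_to_slice N d c (x : M) v : slice_chart N d c -> cdom c x ->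
  tangent_vector x v ->
  (forall j : 'I_(mdim M), (d <= j)%N -> v (fun y => cmap c y ord0 j) = 0) ->
  tangent_to N d x v.
Proof.
move=> sc cx [c0 [w [ac0 c0x dir]]] v0.
exists c, (\row_j v (fun y => cmap c y ord0 j)); split => //.
  by move=> j dj; rewrite mxE v0.
by apply: directional_transfer dir => //; case: sc.
Qed.

(** In the slice chart the segment from x in the direction w stays in N, so the difference quotient
    is eventually 0. *)
Lemma tangent_to_vanishing N d (x : M) v V f : tangent_to N d x v -> N x ->
  open V -> V x -> smooth_on V f -> (forall y, V y -> N y -> f y = 0) ->
  v f = 0.
Proof.
move=> [c [w [[adm sl] cx w0 dir]]] Nx oV Vx sf f0.
rewrite (dir V f oV Vx sf).
have fx : f x = 0 by exact: f0.
apply/lim_near_cst => //=.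
have lin : h *: w + cmap c x @[h --> (0 : R)^'] --> cmap c x.
  rewrite -[in X in _ --> X](add0r (cmap c x)) -[in X in _ --> X](scale0r w).
  apply: cvgD; last exact: cvg_cst.
  by apply: cvgZr_tmp; exact: nbhs_dnbhs.
have : \forall h \near (0 : R)^', (cmap c @` (V `&` cdom c)) (h *: w + cmap c x).
  exact: lin (near_chart_image oV Vx cx).
apply: filterS => h [y [Vy cy] yh] /=.
rewrite -yh !cmapK // fx subr0 f0 ?scaler0 //.
apply/(sl y cy) => j dj; rewrite yh !mxE w0 // mulr0 add0r.
by have := (sl x cx).1 Nx; apply.
Qed.

(** [w] is the a-th coordinate vector of [c], written in [c0]. It bridges slice charts, which are
    merely admissible, and the non-degeneracy condition, which speaks of atlas charts. *)
Lemma coordinate_vector c c0 (x : M) a : atlas c0 -> admissible c ->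
  cdom c0 x -> cdom c x -> exists w : 'rV[R]_(mdim M),
  forall b, 'D_w ((fun y => cmap c y ord0 b) \o cinv c0) (cmap c0 x) =
            (a == b)%:R.
Proof.
move=> ac0 adm c0x cx.
have [ts ts0] := adm c0 ac0.
pose phi y := cmap c0 (cinv c y).
have phix : phi (cmap c x) = cmap c0 x by rewrite /phi cmapK.
exists (\row_j 'D_(delta_mx 0 a) (fun y => phi y ord0 j) (cmap c x)) => b.
have Pphi : (cmap c @` (cdom c `&` cdom c0)) (cmap c x) by exists x.
have dphi j : derivable (fun y => phi y ord0 j) (cmap c x) (delta_mx 0 a).
  by have [+ _] := transition_C1 j ts (delta_mx 0 a); apply.
have Up : (cmap c0 @` (cdom c0 `&` cdom c)) (phi (cmap c x)).
  by rewrite phix; exists x.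
have [_] := is_derive_chain (@transition_open c0 c) (transition_C1 b ts0) Up dphi.
rewrite phix => <-.
have [_] := is_derive_coord (cmap c x) (delta_mx 0 a) b.
rewrite mxE eqxx /= eq_sym => <-.
apply: near_eq_derive.
have := open_nbhs_nbhs (conj (@transition_open c c0) Pphi).
by apply: filterS => _ [z [cz cz'] <-] /=; rewrite /phi cmapK // cmapK.
Qed.

End TangentVectors.

(** * Sections and frames *)

Section SmoothSections.
Context {R : realType} {M : manifold R} (E : vbundle M).
Implicit Types (s t : section E) (f : M -> R) (U V : set M).

Lemma tmapZD i x (a : R) (u v : E x) : tdom i x ->
  tmap i x (a *: u + v) = a *: tmap i x u + tmap i x v.
Proof. by move=> ix; rewrite (tmap_linear ix). Qed.

Lemma tmapD i x (u v : E x) : tdom i x ->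
  tmap i x (u + v) = tmap i x u + tmap i x v.
Proof. by move=> ix; rewrite -[u]scale1r tmapZD // !scale1r. Qed.

Lemma tmap0 i x : tdom i x -> tmap i x (0 : E x) = 0.
Proof.
by move=> ix; apply: (addrI (tmap i x (0 : E x))); rewrite -tmapD // !addr0.
Qed.

Lemma tmapZ i x (a : R) (u : E x) : tdom i x ->
  tmap i x (a *: u) = a *: tmap i x u.
Proof. by move=> ix; rewrite -[a *: u]addr0 tmapZD // tmap0 // addr0. Qed.

Lemma smooth_sec_congr U s t : open U -> (forall x, U x -> s x = t x) ->
  smooth_sec U s -> smooth_sec U t.
Proof.
move=> oU st ss i a; apply: smooth_on_congr (ss i a).
  by apply: openI => //; exact: tdom_open.
by move=> x [Ux _]; rewrite st.
Qed.

Lemma smooth_sec_sub U V s : V `<=` U -> smooth_sec U s -> smooth_sec V s.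
Proof.
by move=> VU ss i a; apply: smooth_on_sub (ss i a) => x [/VU Ux ix].
Qed.

Lemma smooth_sec_local U s :
  (forall x, U x -> exists2 V, V x & smooth_sec V s) -> smooth_sec U s.
Proof.
move=> loc i a; apply: smooth_on_local => x [Ux ix].
by have [V Vx sV] := loc x Ux; exists (V `&` tdom i).
Qed.

Lemma smooth_secD U s t : open U -> smooth_sec U s -> smooth_sec U t ->
  smooth_sec U (secD s t).
Proof.
move=> oU ss st i a.
have oi : open (U `&` tdom i) by apply: openI => //; exact: tdom_open.
apply: (smooth_on_congr oi) (smooth_onD oi (ss i a) (st i a)) => x [_ ix].
by rewrite tmapD // mxE.
Qed.

Lemma smooth_secZ U f s : open U -> smooth_on U f -> smooth_sec U s ->
  smooth_sec U (secZ f s).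
Proof.
move=> oU sf ss i a.
have oi : open (U `&` tdom i) by apply: openI => //; exact: tdom_open.
apply: (smooth_on_congr oi) (smooth_onM oi (smooth_on_sub _ sf) (ss i a)).
  by move=> x [_ ix]; rewrite tmapZ // mxE.
by move=> x [].
Qed.

Lemma smooth_sec0 U : open U -> smooth_sec U ((fun x => 0) : section E).
Proof.
move=> oU i a.
have oi : open (U `&` tdom i) by apply: openI => //; exact: tdom_open.
apply: (smooth_on_congr oi) (smooth_on_cst _ 0) => x [_ ix].
by rewrite tmap0 // mxE.
Qed.

Definition sec_lin (I : Type) (r : seq I) (F : I -> M -> R)
  (s : I -> section E) : section E := fun x => \sum_(i <- r) F i x *: s i x.

Lemma smooth_sec_lin U (I : Type) (r : seq I) F (s : I -> section E) :
  open U -> (forall i, smooth_on U (F i)) -> (forall i, smooth_sec U (s i)) ->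
  smooth_sec U (sec_lin r F s).
Proof.
move=> oU sF ss; elim: r => [|i r IH].
  by apply: smooth_sec_congr (smooth_sec0 oU) => // x _; rewrite /sec_lin big_nil.
apply: smooth_sec_congr (smooth_secD oU (smooth_secZ oU (sF i) (ss i)) IH) => //.
by move=> x _; rewrite /sec_lin big_cons.
Qed.

Lemma smooth_sec_extend V O chi s : open V -> open O ->
  smooth_on setT chi -> (forall y, O y -> chi y = 0) ->
  (forall y, V y \/ O y) -> smooth_sec V s ->
  smooth_sec setT (secZ chi s).
Proof.
move=> oV oO schi chi0 VO ss; apply: smooth_sec_local => y _.
case: (VO y) => [Vy|Oy].
  exists V => //; apply: smooth_secZ => //; exact: smooth_on_sub schi.
exists O => //; apply: smooth_sec_congr (smooth_sec0 oO) => // z Oz.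
by rewrite /secZ chi0// scale0r.
Qed.

(** Constant in the trivialization [i]; in another one its components are constant combinations of
    entries of the transition matrix. *)
Lemma exists_section_through i x (u : E x) : tdom i x ->
  exists2 s : section E, smooth_sec (@tdom _ _ E i) s & s x = u.
Proof.
move=> ix; pose c := tmap i x u.
have ex y : exists v : E y, tdom i y -> tmap i y v = c.
  case: (pselect (tdom i y)) => [iy|niy]; last by exists 0.
  by have [g _ gK] := tmap_bij iy; exists (g c).
pose s : section E := fun y => sval (cid (ex y)).
have sE y : tdom i y -> tmap i y (s y) = c by rewrite /s; case: cid.
exists s; last first.
  by apply: (bij_inj (tmap_bij ix)); rewrite sE.
move=> j a; have [T [sT tT]] := @tmap_transition _ _ E i j.
have oij : open (tdom i `&` @tdom _ _ E j) by apply: openI; exact: tdom_open.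
have st := smooth_on_sum (index_enum 'I_(vrank E)) oij
  (fun b => smooth_onM oij (smooth_on_cst _ (c ord0 b)) (sT b a)).
by apply: (smooth_on_congr oij) st => y [iy jy]; rewrite tT // sE // mxE.
Qed.

End SmoothSections.

Section InnerProduct.
Context {R : realType} {M : manifold R} (E : pe_bundle M).

Lemma ipDl x (u v w : E x) : ip (u + v) w = ip u w + ip v w.
Proof. by rewrite -[u]scale1r ip_linear mul1r !scale1r. Qed.

Lemma ip0l x (w : E x) : ip 0 w = 0.
Proof. by apply: (addrI (ip 0 w)); rewrite -ipDl !addr0. Qed.

Lemma ipZl x a (u w : E x) : ip (a *: u) w = a * ip u w.
Proof. by rewrite -[a *: u]addr0 ip_linear ip0l addr0. Qed.

Lemma ipZr x a (u w : E x) : ip w (a *: u) = a * ip w u.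
Proof. by rewrite ip_sym ipZl (ip_sym w). Qed.

Lemma ip_suml x (I : Type) (r : seq I) (F : I -> E x) (w : E x) :
  ip (\sum_(i <- r) F i) w = \sum_(i <- r) ip (F i) w.
Proof. by elim: r => [|i r IH]; rewrite ?big_nil ?ip0l // !big_cons ipDl IH. Qed.

Lemma ip_sumr x (I : Type) (r : seq I) (F : I -> E x) (w : E x) :
  ip w (\sum_(i <- r) F i) = \sum_(i <- r) ip w (F i).
Proof. by rewrite ip_sym ip_suml; apply: eq_bigr => i _; rewrite ip_sym. Qed.

(** The matrix of the form between the [k i] and a basis of the fibre has independent rows, by
    non-degeneracy; a right inverse contains the components of the dual vectors. *)
Lemma exists_dual_vectors x q (k : 'I_q -> E x) :
  (forall a : 'I_q -> R, \sum_i a i *: k i = 0 -> forall i, a i = 0) ->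
  exists u : 'I_q -> E x, forall i j, ip (k i) (u j) = (i == j)%:R.
Proof.
move=> free; have [i0 ix] := @tdom_cover _ _ E x.
have [g gK Kg] := tmap_bij ix.
pose e b := g (delta_mx 0 b).
have spanE (v : E x) : v = \sum_b tmap i0 x v ord0 b *: e b.
  apply: (can_inj gK); rewrite {1}(row_sum_delta (tmap i0 x v)).
  elim: (index_enum _) => [|b r IH]; first by rewrite !big_nil tmap0.
  by rewrite !big_cons tmapD // tmapZ // Kg IH.
pose A := \matrix_(i < q, b < vrank E) ip (k i) (e b).
have : row_free A.
  rewrite -kermx_eq0; apply/eqP/row_matrixP => i; rewrite row0.
  suff inj (a : 'rV_q) : a *m A = 0 -> a = 0.
    by apply: inj; rewrite -row_mul mulmx_ker row0.
  move=> aA; suff a0 : \sum_j a ord0 j *: k j = 0.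
    by apply/rowP => j; rewrite (free (a ord0) a0) mxE.
  apply: ip_nondeg => v; rewrite (spanE v) ip_sumr big1 // => b _.
  rewrite ipZr ip_suml; have /rowP/(_ b) := aA.
  rewrite mxE [RHS]mxE => ab.
  rewrite (eq_bigr (fun j => a ord0 j * A j b)) ?ab ?mulr0 // => j _.
  by rewrite ipZl mxE.
move=> /row_freeP[B AB].
exists (fun j => \sum_b B b j *: e b) => i j.
have /matrixP/(_ i j) := AB; rewrite !mxE => <-.
by rewrite ip_sumr; apply: eq_bigr => b _; rewrite ipZr mxE mulrC.
Qed.

End InnerProduct.

Lemma near_open (T : topologicalType) (x : T) (P : set T) :
  (\forall y \near x, P y) -> exists2 W : set T, open W /\ W x & W `<=` P.
Proof.
by rewrite -nbhs_nearE topology_structure.nbhsE => -[W [oW Wx] WP]; exists W.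
Qed.

(** * Inverting smooth families of matrices *)

Section SmoothMatrices.
Context {R : realType} {M : manifold R}.

Definition smooth_mx m n (U : set M) (A : M -> 'M[R]_(m, n)) :=
  forall i j, smooth_on U (fun x => A x i j).

Lemma smooth_det n (U : set M) (A : M -> 'M[R]_n) : open U -> smooth_mx U A ->
  smooth_on U (fun x => \det (A x)).
Proof.
move=> oU sA; rewrite /determinant; apply: smooth_on_sum => // s.
apply: smooth_onM => //; first exact: smooth_on_cst.
by apply: smooth_on_prod => // i; exact: sA.
Qed.

Lemma smooth_adj n (U : set M) (A : M -> 'M[R]_n) : open U -> smooth_mx U A ->
  smooth_mx U (fun x => \adj (A x)).
Proof.
move=> oU sA i j.
have : smooth_on U (fun x => (-1) ^+ (j + i) * \det (row' j (col' i (A x)))).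
  apply: smooth_onM => //; first exact: smooth_on_cst.
  apply: smooth_det => // a b.
  by apply: smooth_on_congr (sA (lift j a) (lift i b)) => // x _; rewrite !mxE.
by apply: smooth_on_congr => // x _; rewrite mxE.
Qed.

(** On the neighbourhood where the determinant is non-zero, smoothness follows from the cofactor
    formula. *)
Lemma smooth_inverse n (U : set M) (A : M -> 'M[R]_n) (x : M) : open U -> U x ->
  smooth_mx U A -> A x \in unitmx ->
  exists (W : set M) (B : M -> 'M[R]_n), [/\ open W, W x, W `<=` U,
    smooth_mx W B & forall y, W y -> A y *m B y = 1%:M].
Proof.
move=> oU Ux sA uA.
have d0 : \det (A x) != 0 by rewrite -unitfE -unitmxE.
have cd := smooth_continuous oU Ux (smooth_det oU sA).
have N1 : \forall y \near x, \det (A y) != 0.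
  exact: (cd _ (open_nbhs_nbhs (conj (@open_neq R 0) d0))).
have N2 : \forall y \near x, U y by exact: open_nbhs_nbhs.
have [W [oW Wx] WP] := @near_open M x _ (filterI N1 N2).
exists W, (fun y => invmx (A y)); split => //.
- by move=> y /WP[].
- have sAW : smooth_mx W A.
    by move=> i j; apply: smooth_on_sub (sA i j) => y /WP[].
  move=> i j; have := smooth_onM oW (smooth_onV oW (fun y Wy => (WP y Wy).1)
    (smooth_det oW sAW)) (smooth_adj oW sAW i j).
  apply: smooth_on_congr => // y /WP[dy _].
  by rewrite /invmx unitmxE unitfE dy !mxE.
- by move=> y /WP[dy _]; rewrite mulmxV // unitmxE unitfE.
Qed.

End SmoothMatrices.

(** * Graded algebra and brackets *)

Section GradedAlgebra.
Context {R : realType} {M : manifold R} (C : graded_sheaf M).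
Implicit Types (U V W : set M).

Lemma fn0 U : open U -> fn C U (fun=> 0) = 0.
Proof.
move=> oU; have s0 := smooth_on_cst U 0.
apply: (addrI (fn C U (fun=> 0))); rewrite -fnD // [RHS]addr0.
apply: (fn_eq _ oU (smooth_onD oU s0 s0) s0).2 => x _.
by rewrite addr0.
Qed.

Lemma fn_congr U f g : open U -> smooth_on U f -> (forall x, U x -> f x = g x) ->
  fn C U f = fn C U g.
Proof.
by move=> oU sf fg; apply: (fn_eq _ oU sf (smooth_on_congr oU fg sf)).2.
Qed.

Lemma fnN U f : open U -> smooth_on U f -> fn C U (fun x => - f x) = - fn C U f.
Proof.
move=> oU sf; apply/eqP; rewrite -addr_eq0 -fnD //; last exact: smooth_onN.
have s : smooth_on U (fun x => - f x + f x).
  by apply: smooth_onD => //; exact: smooth_onN.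
by rewrite (fn_congr (g := fun=> 0)) ?fn0 // => x _; rewrite addNr.
Qed.

Lemma fn_sum U (I : Type) (r : seq I) (F : I -> M -> R) : open U ->
  (forall i, smooth_on U (F i)) ->
  fn C U (fun x => \sum_(i <- r) F i x) = \sum_(i <- r) fn C U (F i).
Proof.
move=> oU sF; elim: r => [|i r IH].
  rewrite big_nil -(fn0 oU); apply: fn_congr => // [|x _].
    exact: (smooth_on_sum [::]).
  by rewrite big_nil.
rewrite big_cons -IH -fnD //; last exact: smooth_on_sum.
apply: fn_congr => // [|x _]; first exact: smooth_on_sum.
by rewrite big_cons.
Qed.

Lemma fn_natr U (m : nat) : open U -> fn C U (fun=> m%:R) = m%:R.
Proof.
move=> oU; elim: m => [|m IH]; first by rewrite fn0.
rewrite -[in RHS]addn1 natrD -IH -fn1 // -fnD //; try exact: smooth_on_cst.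
by apply: fn_congr => // [|x _]; [exact: smooth_on_cst|rewrite -addn1 natrD].
Qed.

Lemma hdegN U k (a : C U) : open U -> hdeg k a -> hdeg k (- a).
Proof. by move=> oU ha; rewrite -sub0r; apply: hdegB => //; exact: hdeg0. Qed.

Lemma hdegD U k (a b : C U) : open U -> hdeg k a -> hdeg k b -> hdeg k (a + b).
Proof.
by move=> oU ha hb; rewrite -[b]opprK; apply: hdegB => //; exact: hdegN.
Qed.

Lemma hdeg_bigsum U k (I : Type) (r : seq I) (P : pred I) (F : I -> C U) : open U ->
  (forall i, P i -> hdeg k (F i)) -> hdeg k (\sum_(i <- r | P i) F i).
Proof.
move=> oU hF; elim/big_rec: _ => [|i a Pi ha]; first exact: hdeg0.
by apply: hdegD => //; exact: hF.
Qed.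

Lemma hdeg_one U : open U -> hdeg 0 (1 : C U).
Proof. by move=> oU; rewrite -fn1 //; apply: fn_hdeg => //; exact: smooth_on_cst. Qed.

Lemma hdegMl U k (a b : C U) : open U -> hdeg 0 a -> hdeg k b -> hdeg k (a * b).
Proof. by move=> oU ha hb; have := hdegM oU ha hb. Qed.

Lemma hdeg0_comm U k (a b : C U) : open U -> hdeg 0 a -> hdeg k b -> a * b = b * a.
Proof. by move=> oU ha hb; rewrite (hdeg_comm oU ha hb) mul0n expr0 mul1r. Qed.

Lemma res0 U V : open U -> open V -> V `<=` U -> res V (0 : C U) = 0.
Proof. by move=> oU oV VU; rewrite -{1}(subrr (0 : C U)) resB // subrr. Qed.

Lemma resN U V (a : C U) : open U -> open V -> V `<=` U -> res V (- a) = - res V a.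
Proof. by move=> oU oV VU; rewrite -sub0r resB // res0 // sub0r. Qed.

Lemma resD U V (a b : C U) : open U -> open V -> V `<=` U ->
  res V (a + b) = res V a + res V b.
Proof. by move=> oU oV VU; rewrite -{1}[b]opprK resB // resN // opprK. Qed.

Lemma res_sum U V (I : Type) (r : seq I) (P : pred I) (F : I -> C U) :
  open U -> open V -> V `<=` U ->
  res V (\sum_(i <- r | P i) F i) = \sum_(i <- r | P i) res V (F i).
Proof.
by move=> oU oV VU; apply: big_morph => [a b|]; [exact: resD|exact: res0].
Qed.

(** Homogeneous components are unique, so terms of other degrees cancel among themselves. Membership
    in the ideal yields sums with no control on degrees, which this lemma cleans up. *)
Lemma hdeg_component U m (I : eqType) (r : seq I) (D : I -> nat) (F : I -> C U)
    (a : C U) : open U -> hdeg m a -> (forall i, hdeg (D i) (F i)) ->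
  a = \sum_(i <- r) F i -> a = \sum_(i <- r | D i == m) F i.
Proof.
move=> oU ha hF aE.
(* A bound exceeding [m] and all the degrees that occur in [r]. *)
pose n := (m + \max_(i <- r) D i).+1.
pose b k : C U := \sum_(i <- r | D i == k) F i - (if k == m then a else 0).
have hb k : hdeg k (b k).
  apply: hdegB => //.
    by apply: hdeg_bigsum => // i /eqP <-.
  by case: eqP => [->|_] //; exact: hdeg0.
have mn : (m < n)%N by rewrite /n ltnS leq_addr.
have : \sum_(k < n) b k = 0.
  rewrite sumrB [X in _ - X](bigD1 (Ordinal mn)) //= eqxx.
  rewrite [X in _ - (_ + X)]big1; last first.
    by move=> i; rewrite -val_eqE /= => /negbTE ->.
  rewrite addr0; apply/eqP; rewrite subr_eq0 aE.
  apply/eqP; rewrite (exchange_big_dep xpredT) //=.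
  rewrite big_seq [RHS]big_seq; apply: eq_bigr => i ir.
  have Dn : (D i < n)%N.
    by rewrite /n ltnS (leq_trans _ (leq_addl _ _)) // (leq_bigmax_seq (F:=D)).
  rewrite (bigD1 (Ordinal Dn)) //= big1 ?addr0 // => j /andP[/eqP e].
  by rewrite -val_eqE /= e eqxx.
move=> /(hdeg_free oU hb)/(_ m mn)/eqP.
by rewrite /b eqxx subr_eq0 => /eqP.
Qed.

End GradedAlgebra.

Section Brackets.
Context {R : realType} {M : manifold R} {C : Nmanifold2 M} (S : symplectic C).
Context {U : set M} (oU : open U).
Implicit Types a b c : C U.
Local Notation "{{ a , b }}" := (pb S a b).

Lemma pb0l b : {{ 0, b }} = 0.
Proof. by apply: (addrI {{ 0, b }}); rewrite -pbDl // !addr0. Qed.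

Lemma pb0r b : {{ b, 0 }} = 0.
Proof. by apply: (addrI {{ b, 0 }}); rewrite -pbDr // !addr0. Qed.

Lemma pbNl a b : {{ - a, b }} = - {{ a, b }}.
Proof. by apply/eqP; rewrite -addr_eq0 -pbDl // addNr pb0l. Qed.

Lemma pbNr a b : {{ a, - b }} = - {{ a, b }}.
Proof. by apply/eqP; rewrite -addr_eq0 -pbDr // addNr pb0r. Qed.

Lemma pb_suml (I : Type) (r : seq I) (P : pred I) (F : I -> C U) b :
  {{ \sum_(i <- r | P i) F i, b }} = \sum_(i <- r | P i) {{ F i, b }}.
Proof.
apply: (big_morph (fun a => {{ a, b }})) => [x y|]; [exact: pbDl|exact: pb0l].
Qed.

Lemma pb_sumr (I : Type) (r : seq I) (P : pred I) (F : I -> C U) b :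
  {{ b, \sum_(i <- r | P i) F i }} = \sum_(i <- r | P i) {{ b, F i }}.
Proof.
apply: (big_morph (fun a => {{ b, a }})) => [x y|]; [exact: pbDr|exact: pb0r].
Qed.

Lemma pb_leibniz_l k l m a b c : hdeg k a -> hdeg l b -> hdeg m c ->
  {{ a * b, c }} = a * {{ b, c }} + (-1) ^+ (l * m) * ({{ a, c }} * b).
Proof.
move=> ha hb hc; rewrite (pb_anti S oU (hdegM oU ha hb) hc).
rewrite (pb_leibniz S oU hc ha hb) (pb_anti S oU hc ha) (pb_anti S oU hc hb).
rewrite -!(signr_odd _ (_ * _)) !oddM oddD.
case: (odd k); case: (odd l); case: (odd m); rewrite /= ?expr0 ?expr1;
  rewrite !(mul1r, mulN1r, mulNr, mulrN, opprK, opprD) //; rewrite addrC //.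
Qed.

End Brackets.

(** * The vanishing ideal *)

Section Ideals.
Context {R : realType} {M : manifold R} (E : pe_bundle M).
Variables (N : set M) (K : forall x, set (E x)).
Arguments K : clear implicits.
Context {C : Nmanifold2 M} {S : symplectic C} (P : corresponds S E) (d : nat).
Hypothesis K_perp : forall x, N x -> forall u : E x,
  K x u <-> forall v, K x v -> ip u v = 0.
Implicit Types (U V W : set M).

Lemma K_lin x (a : R) u v : N x -> K x u -> K x v -> K x (a *: u + v).
Proof.
move=> Nx Ku Kv; apply/(K_perp Nx) => w Kw.
by rewrite ip_linear ((K_perp Nx u).1 Ku) // ((K_perp Nx v).1 Kv) // mulr0 addr0.
Qed.

Lemma K_0 x : N x -> K x 0.
Proof. by move=> Nx; apply/(K_perp Nx) => w _; rewrite ip0l. Qed.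

Lemma K_Z x (a : R) u : N x -> K x u -> K x (a *: u).
Proof. by move=> Nx Ku; rewrite -[_ *: _]addr0; apply: K_lin => //; exact: K_0. Qed.

Lemma K_D x u v : N x -> K x u -> K x v -> K x (u + v).
Proof. by move=> Nx Ku Kv; rewrite -[u]scale1r; exact: K_lin. Qed.

Lemma K_isotropic x u v : N x -> K x u -> K x v -> ip u v = 0.
Proof. by move=> Nx Ku Kv; rewrite ((K_perp Nx u).1 Ku). Qed.

Lemma sec_congr U s t : open U -> smooth_sec U s -> (forall x, U x -> s x = t x) ->
  sec P U s = sec P U t.
Proof. by move=> oU ss st; apply: (sec_eq P oU ss (smooth_sec_congr oU st ss)).2. Qed.

(** Ideal membership over one fixed open set, in the very form that [vanishing_ideal] asks for near
    each point of N. The generators stand on the right; [gen_idealMr] recovers right multiples. *)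
Definition gen_ideal V (a : C V) : Prop := exists n (b g : 'I_n -> C V),
  (forall i, ideal_gen N K P d (g i)) /\ a = \sum_i b i * g i.

Definition ideal0 V (g : C V) : Prop := exists f, [/\ smooth_on V f,
  (forall x, V x -> N x -> f x = 0) & g = fn C V f].

Definition ideal1 V (g : C V) : Prop :=
  exists2 s, section_in N K V s & g = sec P V s.

Lemma ideal_gen_hdeg V (g : C V) : open V -> ideal_gen N K P d g ->
  exists k, [/\ hdeg k g, k = 0%N -> ideal0 g & k = 1%N -> ideal1 g].
Proof.
move=> oV [f sf f0|s [ss sK]|X D at1 tX tD].
- by exists 0%N; split => // [|_]; [exact: fn_hdeg|exists f].
- by exists 1%N; split => // [|_]; [exact: sec_hdeg|exists s].
- by exists 2%N; split => //; exact: ati_hdeg.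
Qed.

Lemma atiyah_sub U V X (D : section E -> section E) : V `<=` U ->
  atiyah U X D -> atiyah V X D.
Proof.
move=> VU [[tX sX] DU]; split; first split.
- by move=> x /VU; exact: tX.
- by move=> W f oW WV; apply: sX => //; exact: subset_trans VU.
- by move=> W oW WV; apply: DU => //; exact: subset_trans VU.
Qed.

Lemma ideal_gen_res U V (g : C U) : open U -> open V -> V `<=` U ->
  ideal_gen N K P d g -> ideal_gen N K P d (res V g).
Proof.
move=> oU oV VU [f sf f0|s [ss sK]|X D at1 tX tD].
- rewrite res_fn //; apply: Ideal0; first exact: smooth_on_sub sf.
  by move=> x /VU; exact: f0.
- rewrite res_sec //; apply: Ideal1; split; first exact: smooth_sec_sub ss.
  by move=> x /VU; exact: sK.
- rewrite res_ati //; apply: Ideal2; first exact: atiyah_sub at1.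
    by move=> x /VU; exact: tX.
  by move=> W s oW WV; apply: tD => //; exact: subset_trans VU.
Qed.

Section OverV.
Variables (V : set M) (oV : open V).
Implicit Types a b c : C V.

Lemma gen_ideal0 : gen_ideal (0 : C V).
Proof.
by exists 0%N, (fun=> 0), (fun=> 0); split => [[]|] //; rewrite big_ord0.
Qed.

Lemma gen_idealD a b : gen_ideal a -> gen_ideal b -> gen_ideal (a + b).
Proof.
move=> [n1 [b1 [g1 [G1 ->]]]] [n2 [b2 [g2 [G2 ->]]]].
exists (n1 + n2)%N.
exists (fun i : 'I_(n1 + n2) =>
  match fintype.split i with inl j => b1 j | inr j => b2 j end).
exists (fun i : 'I_(n1 + n2) =>
  match fintype.split i with inl j => g1 j | inr j => g2 j end).
split; first by move=> i; case: (fintype.split i).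
rewrite big_split_ord /=; congr (_ + _); apply: eq_bigr => i _.
  by rewrite (unsplitK (inl i)).
by rewrite (unsplitK (inr i)).
Qed.

Lemma gen_idealMl a b : gen_ideal a -> gen_ideal (b * a).
Proof.
move=> [n [c [g [G ->]]]]; exists n, (fun i => b * c i), g; split => //.
by rewrite mulr_sumr; apply: eq_bigr => i _; rewrite mulrA.
Qed.

Lemma gen_idealN a : gen_ideal a -> gen_ideal (- a).
Proof. by move=> Ja; rewrite -mulN1r; exact: gen_idealMl. Qed.

Lemma gen_idealB a b : gen_ideal a -> gen_ideal b -> gen_ideal (a - b).
Proof. by move=> Ja Jb; apply: gen_idealD => //; exact: gen_idealN. Qed.

Lemma gen_ideal_sum (I : Type) (r : seq I) (Q : pred I) (F : I -> C V) :
  (forall i, Q i -> gen_ideal (F i)) -> gen_ideal (\sum_(i <- r | Q i) F i).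
Proof.
move=> JF; elim/big_rec: _ => [|i a Qi Ja]; first exact: gen_ideal0.
by apply: gen_idealD => //; exact: JF.
Qed.

Lemma gen_ideal_gen a : ideal_gen N K P d a -> gen_ideal a.
Proof.
by move=> ga; exists 1%N, (fun=> 1), (fun=> a); split; rewrite ?big_ord1 ?mul1r.
Qed.

(** Generators are homogeneous, so graded commutativity moves a homogeneous [c] across them. *)
Lemma gen_idealMr l a c : hdeg l c -> gen_ideal a -> gen_ideal (a * c).
Proof.
move=> hc [n [b [g [G ->]]]]; rewrite mulr_suml; apply: gen_ideal_sum => i _.
have [k [hg _ _]] := ideal_gen_hdeg oV (G i).
rewrite -mulrA (hdeg_comm oV hg hc) 2!mulrA.
by apply: gen_idealMl; exact: gen_ideal_gen.
Qed.

(** The Leibniz rule is stated for homogeneous factors, hence the coefficients are split into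
    homogeneous parts. *)
Lemma gen_ideal_homogeneous a : gen_ideal a -> exists (I : finType)
  (b g : I -> C V) (D : I -> nat), [/\ (forall i, ideal_gen N K P d (g i)),
    (forall i, hdeg (D i) (b i)) & a = \sum_i b i * g i].
Proof.
move=> [n [b [g [G aE]]]].
have /choice[m /choice[c hc]] := fun i => hdeg_sum (b i) oV.
(* The numbers of components differ with i; padding with zeros makes the index set a product. *)
pose mm := \max_i m i.
exists ('I_n * 'I_mm)%type.
exists (fun p : 'I_n * 'I_mm => if (p.2 < m p.1)%N then c p.1 p.2 else 0).
exists (fun p : 'I_n * 'I_mm => g p.1), (fun p : 'I_n * 'I_mm => p.2 : nat); split.
- by move=> p; exact: G.
- by move=> p; case: ifP => _; [exact: (hc _).1|exact: hdeg0].
- rewrite aE -(pair_bigA _ (fun (i : 'I_n) (k : 'I_mm) =>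
    (if (k < m i)%N then c i k else 0) * g i)) /=.
  apply: eq_bigr => i _; rewrite -mulr_suml; congr (_ * _).
  rewrite (hc i).2 (big_ord_widen mm (c i)) ?big_mkcond //.
  exact: leq_bigmax.
Qed.

Lemma gen_ideal_component k a : gen_ideal a -> hdeg k a -> exists (I : finType)
  (Q : pred I) (b g : I -> C V) (D D' : I -> nat),
  [/\ (forall i, hdeg (D i) (b i)),
      (forall i, [/\ hdeg (D' i) (g i), D' i = 0%N -> ideal0 (g i) &
                                        D' i = 1%N -> ideal1 (g i)]),
      (forall i, Q i -> (D i + D' i)%N = k) & a = \sum_(i | Q i) b i * g i].
Proof.
move=> /gen_ideal_homogeneous[I [b [g [D [G hb aE]]]]] ha.
have /choice[D' hD'] := fun i => ideal_gen_hdeg oV (G i).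
exists I, (fun i => D i + D' i == k)%N, b, g, D, D'; split => //.
  by move=> i /eqP.
apply: (hdeg_component (D := fun i => (D i + D' i)%N) oV ha _ aE) => i.
by apply: hdegM => //; have [] := hD' i.
Qed.

Lemma ideal0_sum (I : Type) (r : seq I) (Q : pred I) (F : I -> C V) :
  (forall i, Q i -> ideal0 (F i)) -> ideal0 (\sum_(i <- r | Q i) F i).
Proof.
move=> hF; elim/big_rec: _ => [|i a Qi [g [sg g0 ->]]].
  by exists (fun=> 0); split => //; [exact: smooth_on_cst|rewrite fn0].
have [f [sf f0 ->]] := hF i Qi.
exists (fun x => f x + g x); split; first exact: smooth_onD.
  by move=> x Vx Nx; rewrite f0 // g0 // addr0.
by rewrite fnD.
Qed.

Lemma ideal1_sum (I : Type) (r : seq I) (Q : pred I) (F : I -> C V) :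
  (forall i, Q i -> ideal1 (F i)) -> ideal1 (\sum_(i <- r | Q i) F i).
Proof.
move=> hF; elim/big_rec: _ => [|i a Qi [t [st tK] ->]].
  exists (secZ (fun=> 0) (fun x => 0)).
    split; first by apply: smooth_secZ => //; [exact: smooth_on_cst|exact: smooth_sec0].
    by move=> x _ Nx; rewrite /secZ scale0r; exact: K_0.
  rewrite sec_scale ?fn0 ?mul0r //; [exact: smooth_on_cst|exact: smooth_sec0].
have [s [ss sK] ->] := hF i Qi.
exists (secD s t); last by rewrite sec_add.
split; first exact: smooth_secD.
by move=> x Vx Nx; apply: K_D => //; [exact: sK|exact: tK].
Qed.

(** In degree 0 only products of a function with a generator of degree 0 survive, so the ideal
    contains no new functions. *)
Lemma gen_ideal_deg0 f : smooth_on V f -> gen_ideal (fn C V f) ->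
  forall x, V x -> N x -> f x = 0.
Proof.
move=> sf /gen_ideal_component /(_ (fn_hdeg C oV sf)).
move=> [I [Q [b [g [D [D' [hb hg QD aE]]]]]]].
suff [h [sh h0 E1]] : ideal0 (fn C V f).
  by move=> x Vx Nx; rewrite ((fn_eq C oV sf sh).1 E1) // h0.
rewrite aE; apply: ideal0_sum => i Qi.
have := QD i Qi; have [hgi + _] := hg i; have := hb i.
case: (D i) => // hbi; case: (D' i) => // /(_ erefl)[h [sh h0 ->]] _.
have [h' sh' ->] := fn_onto oV hbi.
exists (fun x => h' x * h x); split; [exact: smooth_onM| |by rewrite fnM].
by move=> x Vx Nx; rewrite h0 // mulr0.
Qed.

(** Degree 1 splits as 0 + 1 or 1 + 0: a function times a section of I_1, or a section times a
    function of I_0. Both take values in K along N. *)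
Lemma gen_ideal_deg1 s : smooth_sec V s -> gen_ideal (sec P V s) ->
  section_in N K V s.
Proof.
move=> ss /gen_ideal_component /(_ (sec_hdeg P oV ss)).
move=> [I [Q [b [g [D [D' [hb hg QD aE]]]]]]].
suff [t [st tK] E1] : ideal1 (sec P V s).
  split => // x Vx Nx; rewrite ((sec_eq P oV ss st).1 E1) //; exact: tK.
rewrite aE; apply: ideal1_sum => i Qi.
have := QD i Qi; have [hgi] := hg i; have := hb i.
case: (D i) => [|[|//]] hbi; case: (D' i) => [|[|//]] //.
- move=> _ /(_ erefl)[t [st tK] ->] _.
  have [h' sh' ->] := fn_onto oV hbi.
  exists (secZ h' t); last by rewrite sec_scale.
  split; first exact: smooth_secZ.
  by move=> x Vx Nx; apply: K_Z => //; exact: tK.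
- move=> /(_ erefl)[h [sh h0 ->]] _ _.
  have [t st ->] := sec_onto P oV hbi.
  rewrite -(hdeg0_comm oV (fn_hdeg C oV sh) (sec_hdeg P oV st)).
  exists (secZ h t); last by rewrite sec_scale.
  split; first exact: smooth_secZ.
  by move=> x Vx Nx; rewrite /secZ h0 // scale0r; exact: K_0.
Qed.

(** By the Leibniz rule, stability under a bracket need only be checked on generators. *)
Lemma gen_ideal_pb m c a : hdeg m c ->
  (forall g, ideal_gen N K P d g -> gen_ideal (pb S c g)) ->
  gen_ideal a -> gen_ideal (pb S c a).
Proof.
move=> hc cG /gen_ideal_homogeneous[I [b [g [D [G hb ->]]]]].
rewrite pb_sumr //; apply: gen_ideal_sum => i _.
have [k [hg _ _]] := ideal_gen_hdeg oV (G i).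
rewrite (pb_leibniz S oV hc (hb i) hg); apply: gen_idealD.
  by apply: gen_idealMl; exact: gen_ideal_gen.
by do 2![apply: gen_idealMl]; exact: cG.
Qed.

Lemma atiyah_smooth X (D : section E -> section E) f : atiyah V X D ->
  smooth_on V f -> smooth_on V (X f).
Proof. by move=> [[_ +] _]; apply. Qed.

Lemma atiyah_smooth_sec X (D : section E -> section E) s : atiyah V X D ->
  smooth_sec V s -> smooth_sec V (D s).
Proof. by move=> [_ /(_ V oV (@subset_refl _ _))[+ _ _ _ _]]; apply. Qed.

(** Brackets of a function with degrees 0 and 1 vanish, and an operator in I_2 differentiates [f]
    along N. *)
Lemma gen_ideal_pb_fn f a : smooth_on V f ->
  (forall x, V x -> N x -> f x = 0) -> gen_ideal a ->
  gen_ideal (pb S (fn C V f) a).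
Proof.
move=> sf f0; have hf := fn_hdeg C oV sf.
apply: (gen_ideal_pb hf) => _ [h sh h0|s [ss sK]|X D at1 tX tD].
- by rewrite (pb_low S oV hf (fn_hdeg C oV sh)) //; exact: gen_ideal0.
- by rewrite (pb_low S oV hf (sec_hdeg P oV ss)) //; exact: gen_ideal0.
- rewrite (pb_anti S oV hf (ati_hdeg P oV at1)) pb_ati_fn //.
  apply: gen_idealN; apply: gen_idealMl; apply: gen_ideal_gen.
  apply: Ideal0; first exact: atiyah_smooth at1 sf.
  by move=> x Vx Nx; exact: tangent_to_vanishing (tX x Vx Nx) Nx oV Vx sf f0.
Qed.

Lemma gen_ideal_pb_sec s a : section_in N K V s -> gen_ideal a ->
  gen_ideal (pb S (sec P V s) a).
Proof.
move=> [ss sK]; have hs := sec_hdeg P oV ss.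
apply: (gen_ideal_pb hs) => _ [h sh h0|t [st tK]|X D at1 tX tD].
- by rewrite (pb_low S oV hs (fn_hdeg C oV sh)) //; exact: gen_ideal0.
- rewrite pb_sec_sec //; apply: gen_ideal_gen; apply: Ideal0.
    exact: ip_smooth.
  by move=> x Vx Nx; apply: K_isotropic => //; [exact: sK|exact: tK].
- rewrite (pb_anti S oV hs (ati_hdeg P oV at1)) pb_ati_sec //.
  apply: gen_idealN; apply: gen_idealMl; apply: gen_ideal_gen.
  by apply: Ideal1; apply: tD.
Qed.

End OverV.

Lemma gen_ideal_res U V (a : C U) : open U -> open V -> V `<=` U ->
  gen_ideal a -> gen_ideal (res V a).
Proof.
move=> oU oV VU [n [b [g [G ->]]]].
exists n, (fun i => res V (b i)), (fun i => res V (g i)); split.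
  by move=> i; exact: ideal_gen_res.
by rewrite res_sum //; apply: eq_bigr => i _; rewrite resM.
Qed.

End Ideals.

(** * Adapted frames *)

Section SectionElements.
Context {R : realType} {M : manifold R} {E : pe_bundle M}.
Context {C : Nmanifold2 M} {S : symplectic C} (P : corresponds S E).
Context {V : set M} (oV : open V).

Lemma sec0 : sec P V (fun x => 0) = 0.
Proof.
have s0 := @smooth_sec0 _ _ E V oV.
have := sec_scale P oV (smooth_on_cst V 0) s0.
rewrite fn0 // mul0r => <-; apply: sec_congr => // x _.
by rewrite /secZ scaler0.
Qed.

Lemma sec_sec_lin (I : Type) (r : seq I) F (s : I -> section E) :
  (forall i, smooth_on V (F i)) -> (forall i, smooth_sec V (s i)) ->
  sec P V (sec_lin r F s) = \sum_(i <- r) fn C V (F i) * sec P V (s i).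
Proof.
move=> sF ss; elim: r => [|i r IH].
  rewrite big_nil -sec0; apply: sec_congr => // [|x _].
    exact: smooth_sec_lin.
  by rewrite /sec_lin big_nil.
rewrite big_cons -IH -sec_scale // -sec_add //; last exact: smooth_sec_lin.
  apply: sec_congr => // [|x _]; first exact: smooth_sec_lin.
  by rewrite /sec_lin big_cons.
exact: smooth_secZ.
Qed.

Lemma pb_secM_fn s t f : smooth_sec V s -> smooth_sec V t -> smooth_on V f ->
  pb S (sec P V s * sec P V t) (fn C V f) = 0.
Proof.
move=> ss st sf.
have [[hs ht] hf] := (sec_hdeg P oV ss, sec_hdeg P oV st, fn_hdeg C oV sf).
rewrite (pb_leibniz_l S oV hs ht hf) (pb_low S oV hs hf) //.
by rewrite (pb_low S oV ht hf) // mulr0 mul0r mulr0 addr0.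
Qed.

(** This is the skew operator u |-> <t,u> s - <s,u> t, the image of s wedge t in so(E). *)
Lemma pb_secM_sec s t u : smooth_sec V s -> smooth_sec V t -> smooth_sec V u ->
  pb S (sec P V s * sec P V t) (sec P V u) =
  sec P V (secD (secZ (fun x => ip (t x) (u x)) s)
                (secZ (fun x => - ip (s x) (u x)) t)).
Proof.
move=> ss st su.
have [[hs ht] hu] := (sec_hdeg P oV ss, sec_hdeg P oV st, sec_hdeg P oV su).
have itu : smooth_on V (fun x => ip (t x) (u x)) by exact: ip_smooth.
have isu : smooth_on V (fun x => ip (s x) (u x)) by exact: ip_smooth.
have nsu := smooth_onN oV isu.
rewrite (pb_leibniz_l S oV hs ht hu) !pb_sec_sec // sec_add //; try exact: smooth_secZ.
rewrite !sec_scale // fnN // expr1 mulN1r mulNr.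
by rewrite (hdeg0_comm oV (fn_hdeg C oV itu) hs).
Qed.

End SectionElements.

Section AdaptedFrame.
Context {R : realType} {M : manifold R} (E : pe_bundle M).
Variables (N : set M) (K : forall x, set (E x)).
Arguments K : clear implicits.
Context {C : Nmanifold2 M} {S : symplectic C} (P : corresponds S E) (d q : nat).
Hypothesis K_perp : forall x, N x -> forall u : E x,
  K x u <-> forall v, K x v -> ip u v = 0.
Variables (V : set M) (oV : open V).
Implicit Types a b h : C V.

(* The coordinates of index j >= d in the slice chart c are local equations
   of N. *)
Record adapted (k l : 'I_q -> section E) (c : chart R M (mdim M))
    (Q : 'I_(mdim M) -> C V) : Prop := Adapted {
  adapted_k : forall i, section_in N K V (k i);
  adapted_span : forall x, V x -> N x -> forall u, K x u ->
    exists a : 'I_q -> R, u = \sum_i a i *: k i x;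
  adapted_l : forall i, smooth_sec V (l i);
  adapted_dual : forall x, V x -> forall i j, ip (k i x) (l j x) = (i == j)%:R;
  adapted_slice : slice_chart N d c;
  adapted_dom : V `<=` cdom c;
  adapted_Q : forall i, hdeg 2 (Q i);
  adapted_Qy : forall i j : 'I_(mdim M), (d <= i)%N -> (d <= j)%N ->
    pb S (Q i) (fn C V (fun x => cmap c x ord0 j)) = (i == j)%:R;
  adapted_deg3 : forall a, hdeg 3 a -> exists n (b h : 'I_n -> C V),
    [/\ forall i, hdeg 1 (b i), forall i, hdeg 2 (h i) & a = \sum_i b i * h i] }.

Variables (k l : 'I_q -> section E) (c : chart R M (mdim M)).
Variable Q : 'I_(mdim M) -> C V.
Hypothesis adapt : adapted k l c Q.

Let kE i := sec P V (k i).
Let lE i := sec P V (l i).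
Let y (j : 'I_(mdim M)) x := cmap c x ord0 j.
Let J := gen_ideal N K P d (V := V).

Let sk i : smooth_sec V (k i). Proof. by have [] := adapted_k adapt i. Qed.
Let sl i : smooth_sec V (l i). Proof. exact: (adapted_l adapt). Qed.
Let hk i : hdeg 1 (kE i). Proof. exact: sec_hdeg. Qed.
Let hl i : hdeg 1 (lE i). Proof. exact: sec_hdeg. Qed.
Let sy j : smooth_on V (y j).
Proof.
apply: smooth_on_sub (adapted_dom adapt) _; apply: smooth_on_coord.
by case: (adapted_slice adapt).
Qed.
Let hy j : hdeg 0 (fn C V (y j)). Proof. exact: fn_hdeg. Qed.
Let y0 (j : 'I_(mdim M)) x : (d <= j)%N -> V x -> N x -> y j x = 0.
Proof.
move=> dj Vx Nx; have [_ sl0] := adapted_slice adapt.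
exact: (sl0 x (adapted_dom adapt Vx)).1.
Qed.

Lemma pb_kl i j : pb S (kE i) (lE j) = (i == j)%:R.
Proof.
rewrite /kE /lE pb_sec_sec // -fn_natr //; apply: fn_congr => //.
  exact: ip_smooth.
by move=> x Vx; rewrite (adapted_dual adapt).
Qed.

(** Homogeneous polynomials of degree [r] in the [l_i] with functions as coefficients; the recursive
    form turns statements about them into inductions on [r]. *)
Fixpoint lmon (r : nat) (a : C V) : Prop :=
  if r is r'.+1 then
    exists2 b, (forall i, lmon r' (b i)) & a = \sum_i lE i * b i
  else hdeg 0 a.

Lemma lmon_hdeg r a : lmon r a -> hdeg r a.
Proof.
elim: r a => [//|r IH] a [b hb ->]; apply: hdeg_bigsum => // i _.
exact: (hdegM oV (hl i) (IH _ (hb i))).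
Qed.

Lemma lmon0 r : lmon r 0.
Proof.
elim: r => [|r IH] /=; first exact: hdeg0.
by exists (fun=> 0) => //; rewrite big1 // => i _; rewrite mulr0.
Qed.

Lemma lmonD r a b : lmon r a -> lmon r b -> lmon r (a + b).
Proof.
elim: r a b => [|r IH] a b /=; first exact: hdegD.
move=> [a' ha ->] [b' hb ->]; exists (fun i => a' i + b' i).
  by move=> i; exact: IH.
by rewrite -big_split; apply: eq_bigr => i _; rewrite mulrDr.
Qed.

Lemma lmonMl r a b : hdeg 0 b -> lmon r a -> lmon r (b * a).
Proof.
move=> h0; elim: r a => [|r IH] a /=; first exact: hdegMl.
move=> [a' ha ->]; exists (fun i => b * a' i); first by move=> i; exact: IH.
rewrite mulr_sumr; apply: eq_bigr => i _.
by rewrite !mulrA (hdeg0_comm oV h0 (hl i)).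
Qed.

Lemma lmonN r a : lmon r a -> lmon r (- a).
Proof.
move=> ha; rewrite -mulN1r; apply: lmonMl => //.
by apply: hdegN => //; exact: hdeg_one.
Qed.

(** This is why bracketing with [y_j] isolates the coefficients of the [Q_i]. *)
Lemma lmon_pb_fn r f a : smooth_on V f -> lmon r a -> pb S (fn C V f) a = 0.
Proof.
move=> sf; have hf := fn_hdeg C oV sf.
elim: r a => [|r IH] a /=; first by move=> ha; rewrite (pb_low S oV hf ha).
move=> [b hb ->]; rewrite pb_sumr // big1 // => i _.
rewrite (pb_leibniz S oV hf (hl i) (lmon_hdeg (hb i))) (IH _ (hb i)) !mulr0 addr0.
by rewrite (pb_low S oV hf (hl i)) // mul0r.
Qed.

(** Since {k_m, l_i} = delta_mi, the bracket with [k_m] acts as the odd derivation d/dl_m. *)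
Lemma pb_k_lmon m r (b : 'I_q -> C V) : (forall i, lmon r (b i)) ->
  pb S (kE m) (\sum_i lE i * b i) = b m - \sum_i lE i * pb S (kE m) (b i).
Proof.
move=> hb; rewrite pb_sumr //.
under eq_bigr do rewrite (pb_leibniz S oV (hk m) (hl _) (lmon_hdeg (hb _)))
  pb_kl expr1 mulN1r.
rewrite sumrB (bigD1 m) //= eqxx mul1r big1 ?addr0 // => i im.
by rewrite eq_sym (negbTE im) mul0r.
Qed.

Lemma lmon_pb_k m r a : lmon r.+1 a -> lmon r (pb S (kE m) a).
Proof.
elim: r a => [|r IH] a [b hb ->].
  rewrite (@pb_k_lmon m 0 b hb) big1 ?subr0; first exact: hb.
  by move=> i _; rewrite (pb_low S oV (hk m) (hb i)) // mulr0.
rewrite (@pb_k_lmon m r.+1 b hb).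
apply: lmonD; first exact: hb.
apply: lmonN; exists (fun i => pb S (kE m) (b i)) => // i.
exact/IH/hb.
Qed.

(** Moving l_m past l_i produces a sign that cancels the one of the odd derivation, so each factor
    l_i counts once. *)
Lemma lmon_euler r a : lmon r a -> \sum_m lE m * pb S (kE m) a = r%:R * a.
Proof.
elim: r a => [|r IH] a.
  move=> ha; rewrite mul0r big1 // => m _.
  by rewrite (pb_low S oV (hk m) ha) // mulr0.
move=> [b hb ->].
under eq_bigr do rewrite (@pb_k_lmon _ r b hb) mulrBr mulr_sumr.
rewrite sumrB exchange_big /= -natr1 mulrDl mul1r [RHS]addrC; congr (_ + _).
rewrite mulr_sumr -sumrN; apply: eq_bigr => i _.
have comm_l m : lE m * lE i = - (lE i * lE m).
  by rewrite (hdeg_comm oV (hl m) (hl i)) expr1 mulN1r.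
under eq_bigr do rewrite mulrA comm_l mulNr -mulrA.
rewrite sumrN opprK -mulr_sumr (IH _ (hb i)) !mulrA; congr (_ * _).
by rewrite mulr_natr mulr_natl.
Qed.

Fixpoint kbracket (r : nat) (a : C V) : Prop :=
  if r is r'.+1 then forall m, kbracket r' (pb S (kE m) a) else J a.

Lemma ideal_kbracket r a : J a -> kbracket r a.
Proof.
elim: r a => [//|r IH] a Ja m /=; apply: IH.
by apply: gen_ideal_pb_sec => //; exact: (adapted_k adapt).
Qed.

Lemma kbracketB r a b : kbracket r a -> kbracket r b -> kbracket r (a - b).
Proof.
elim: r a b => [|r IH] a b /=; first exact: gen_idealB.
by move=> ha hb m; rewrite pbDr // pbNr //; exact: IH.
Qed.

(** Each {k_m, a} has one degree less and falls under the induction; Euler's identity then puts a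
    non-zero multiple of [a] in the ideal. Division is multiplication by a constant function. *)
Lemma lmon_ideal r a : lmon r a -> kbracket r a -> J a.
Proof.
elim: r a => [//|r IH] a ha ka.
have : J (\sum_m lE m * pb S (kE m) a).
  apply: gen_ideal_sum.
  move=> m _; apply: gen_idealMl; apply: IH; last exact: ka.
  exact: lmon_pb_k.
rewrite (lmon_euler ha) => /(gen_idealMl (fn C V (fun=> r.+1%:R^-1))).
rewrite mulrA -fn_natr // -fnM //; try exact: smooth_on_cst.
rewrite (fn_congr _ oV (g := fun=> 1)) ?fn1 ?mul1r //.
  exact: smooth_on_cst.
by move=> x _; rewrite mulVf // pnatr_eq0.
Qed.

(** s - sum_j <s,k_j> l_j is orthogonal to every k_i, so along N it lies in K^perp = K. *)
Lemma deg1_decomposition a : hdeg 1 a -> exists2 b, lmon 1 b & J (a - b).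
Proof.
move=> /(sec_onto P oV)[s ss ->].
have sip j : smooth_on V (fun x => ip (s x) (k j x)) by exact: ip_smooth.
have sN j : smooth_on V (fun x => - ip (s x) (k j x)) by exact: smooth_onN.
exists (\sum_j lE j * fn C V (fun x => ip (s x) (k j x))).
  by exists (fun j => fn C V (fun x => ip (s x) (k j x))) => // j; exact: fn_hdeg.
pose t := secD s (sec_lin (index_enum 'I_q) (fun j x => - ip (s x) (k j x)) l).
have tE : sec P V t = sec P V s - \sum_j lE j * fn C V (fun x => ip (s x) (k j x)).
  rewrite /t sec_add //; last exact: smooth_sec_lin.
  rewrite sec_sec_lin //; congr (_ + _); rewrite -sumrN; apply: eq_bigr => j _.
  by rewrite fnN // mulNr (hdeg0_comm oV (fn_hdeg C oV (sip j)) (hl j)).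
rewrite -tE; apply: gen_ideal_gen; apply: Ideal1; split.
  by apply: smooth_secD => //; exact: smooth_sec_lin.
move=> x Vx Nx; apply/(K_perp Nx) => v /(adapted_span adapt Vx Nx)[w ->].
rewrite ip_sumr big1 // => i _; rewrite ipZr.
rewrite /t /secD ipDl /sec_lin ip_suml (bigD1 i) //= big1 ?addr0.
  by rewrite ipZl (ip_sym (l i x)) (adapted_dual adapt) // eqxx mulr1 subrr mulr0.
move=> j ji; rewrite ipZl (ip_sym (l j x)) (adapted_dual adapt) //.
by rewrite eq_sym (negbTE ji) mulr0.
Qed.


Lemma adapted_coordinates x s : V x -> N x -> K x (s x) ->
  s x = \sum_m ip (l m x) (s x) *: k m x.
Proof.
move=> Vx Nx /(adapted_span adapt Vx Nx)[w sE]; rewrite {1}sE.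
apply: eq_bigr => m _; congr (_ *: _).
rewrite sE ip_sumr (bigD1 m) //= big1 ?addr0.
  by rewrite ipZr ip_sym (adapted_dual adapt) // eqxx mulr1.
by move=> i im; rewrite ipZr ip_sym (adapted_dual adapt) // (negbTE im) mulr0.
Qed.

(* Subtracting from an infinitesimal isometry D with symbol tangent to N the
   element of so(E) which has the same components <D k_i, k_j> leaves an
   operator preserving K. *)
Lemma tangent_decomposition a : hdeg 2 a ->
  (forall j : 'I_(mdim M), (d <= j)%N -> pb S a (fn C V (y j)) = 0) ->
  exists2 b : 'I_q -> C V, (forall i, hdeg 1 (b i)) & J (a - \sum_i lE i * b i).
Proof.
move=> ha ay; have [X [D [atX aE]]] := ati_onto P oV ha.
have sD s : smooth_sec V s -> smooth_sec V (D s) by exact: (atiyah_smooth_sec oV atX).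
(* Pairing the correction sum_m (1/2) l_m D(k_m), applied to s in K, with k_j gives (1/2) <D k_j, s>
   from each of its two terms, the second by skewness of <D k_m, k_j> along N. The total <D k_j, s>
   cancels <D s, k_j>. *)
pose half m : section E := secZ (fun=> 2^-1) (l m).
have sh m : smooth_sec V (half m).
  by apply: smooth_secZ => //; exact: smooth_on_cst.
pose w m := sec P V (D (k m)).
have hw m : hdeg 1 (w m) by apply: sec_hdeg => //; exact: sD.
have half0 : hdeg 0 (fn C V (fun=> - 2^-1)).
  by apply: fn_hdeg => //; exact: smooth_on_cst.
exists (fun m => fn C V (fun=> - 2^-1) * w m).
  by move=> m; exact: hdegMl.
set a' := a - _.
have a'E : a' = a + \sum_m sec P V (half m) * w m.
  rewrite /a' -sumrN; congr (_ + _); apply: eq_bigr => m _.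
  rewrite mulrA -(hdeg0_comm oV half0 (hl m)) fnN; last exact: smooth_on_cst.
    by rewrite mulNr mulNr opprK -sec_scale //; exact: smooth_on_cst.
  by [].
have ha' : hdeg 2 a'.
  rewrite a'E; apply: hdegD => //; apply: hdeg_bigsum => // m _.
  exact: (hdegM oV (sec_hdeg P oV (sh m)) (hw m)).
have [X' [D' [atX' a'E']]] := ati_onto P oV ha'.
have yX (Y : (M -> R) -> M -> R) (B : section E -> section E) j x :
    atiyah V Y B -> pb S (ati P V Y B) (fn C V (y j)) = 0 -> V x -> Y (y j) x = 0.
  move=> atY; rewrite pb_ati_fn // -(fn0 C oV) => /(fn_eq C oV) e; apply: e.
    exact: atiyah_smooth atY _.
  exact: smooth_on_cst.
have tan (Y : (M -> R) -> M -> R) (B : section E -> section E) : atiyah V Y B ->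
    (forall j : 'I_(mdim M), (d <= j)%N ->
       pb S (ati P V Y B) (fn C V (y j)) = 0) ->
    forall x, V x -> N x -> tangent_to N d x (fun f => Y f x).
  move=> atY Yy x Vx Nx.
  apply: (tangent_to_slice (adapted_slice adapt) (adapted_dom adapt Vx)).
    exact: atY.1.1.
  by move=> j dj; apply: yX atY _ Vx; exact: Yy.
have a'y (j : 'I_(mdim M)) : (d <= j)%N -> pb S a' (fn C V (y j)) = 0.
  move=> dj; rewrite a'E pbDl // ay // add0r pb_suml // big1 // => m _.
  by apply: pb_secM_fn => //; exact: sD.
have tanX : forall x, V x -> N x -> tangent_to N d x (fun f => X f x).
  by apply: (tan X D atX); rewrite -aE.
apply: gen_ideal_gen; rewrite -/a' a'E'; apply: Ideal2 => //.
  by apply: (tan X' D' atX'); rewrite -a'E'.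
move=> W s oW WV [ss sK].
have atW := atiyah_sub WV atX; have atW' := atiyah_sub WV atX'.
have kW m : smooth_sec W (k m) by exact: smooth_sec_sub (sk m).
have DkW m : smooth_sec W (D (k m)) by exact: smooth_sec_sub (sD _ (sk m)).
have hW m : smooth_sec W (half m) by exact: smooth_sec_sub (sh m).
have DsW : smooth_sec W (D s) by exact: (atiyah_smooth_sec oW atW ss).
have D'sW : smooth_sec W (D' s) by exact: (atiyah_smooth_sec oW atW' ss).
split => //.
have i1 m : smooth_on W (fun x => ip (D (k m) x) (s x)) by exact: ip_smooth.
have i2 m : smooth_on W (fun x => - ip (half m x) (s x)).
  by apply: smooth_onN => //; exact: ip_smooth.
pose T : section E := fun x => D s x +
  \sum_m (ip (D (k m) x) (s x) *: half m x - ip (half m x) (s x) *: D (k m) x).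
pose T' m := secD (secZ (fun x => ip (D (k m) x) (s x)) (half m))
                  (secZ (fun x => - ip (half m x) (s x)) (D (k m))).
have sT' m : smooth_sec W (T' m) by apply: smooth_secD => //; exact: smooth_secZ.
pose one (m : 'I_q) (x : M) : R := 1.
have s1 m : smooth_on W (one m) by exact: smooth_on_cst.
have sTT : smooth_sec W (sec_lin (index_enum 'I_q) one T').
  exact: smooth_sec_lin.
(* [D'] is known only through [ati_onto]; its value on [s] is recovered from the bracket {a', s}. *)
have E1 : sec P W (D' s) = sec P W (secD (D s) (sec_lin (index_enum 'I_q) one T')).
  rewrite -(pb_ati_sec P oW atW' ss) -(res_ati P oV oW WV atX') -a'E' a'E.
  rewrite resD // res_sum // aE res_ati // pbDl // pb_ati_sec // pb_suml //.
  rewrite sec_add // sec_sec_lin //; congr (_ + _); apply: eq_bigr => m _.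
  rewrite fn1 // mul1r resM // /w !res_sec //; last exact: sD.
  exact: pb_secM_sec.
have sTs : smooth_sec W (secD (D s) (sec_lin (index_enum 'I_q) one T')).
  exact: smooth_secD.
have D'E := (sec_eq P oW D'sW sTs).1 E1.
move=> x Wx Nx; have Vx := WV x Wx.
(* <s,t> vanishes on N and X is tangent to N, so the metric property of D yields skewness there. *)
have antisym t : section_in N K W t -> ip (D s x) (t x) + ip (s x) (D t x) = 0.
  move=> [st tK]; have [_ _ _ _ metric] := atX.2 W oW WV.
  rewrite -(metric s t ss st x Wx).
  apply: (tangent_to_vanishing (tanX x Vx Nx) Nx oW Wx); first exact: ip_smooth.
  by move=> z Wz Nz; apply: (K_isotropic K_perp Nz); [exact: sK|exact: tK].
have kin m : section_in N K W (k m).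
  by split => // z Wz Nz; have [_] := adapted_k adapt m; apply => //; exact: WV.
apply/(K_perp Nx) => v /(adapted_span adapt Vx Nx)[u ->].
rewrite ip_sumr big1 // => j _; rewrite ipZr D'E // /secD ipDl /sec_lin ip_suml.
suff -> : \sum_i ip (1 *: T' i x) (k j x) = ip (s x) (D (k j) x).
  by rewrite antisym // mulr0.
have lk m : ip (l m x) (k j x) = (j == m)%:R by rewrite ip_sym (adapted_dual adapt).
have -> : \sum_i ip (1 *: T' i x) (k j x) = 2^-1 * ip (D (k j) x) (s x)
    - 2^-1 * \sum_m ip (l m x) (s x) * ip (D (k m) x) (k j x).
  have -> : 2^-1 * ip (D (k j) x) (s x) =
      \sum_m (j == m)%:R * (2^-1 * ip (D (k m) x) (s x)).
    rewrite (bigD1 j) //= eqxx mul1r big1 ?addr0 // => m.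
    by rewrite eq_sym => /negbTE ->; rewrite mul0r.
  rewrite mulr_sumr -sumrB; apply: eq_bigr => m _.
  by rewrite scale1r /T' /secD /secZ /half ipDl !ipZl lk; ring.
have -> : \sum_m ip (l m x) (s x) * ip (D (k m) x) (k j x) = - ip (D (k j) x) (s x).
  rewrite {2}(adapted_coordinates Vx Nx (sK x Wx Nx)) ip_sumr -sumrN.
  apply: eq_bigr => m _; rewrite ipZr -mulrN; congr (_ * _).
  apply/eqP; rewrite -addr_eq0.
  have [_ _ _ _ metric] := atX.2 W oW WV.
  rewrite (ip_sym (D (k j) x)) -(metric _ _ (kW m) (kW j) x Wx); apply/eqP.
  apply: (tangent_to_vanishing (tanX x Vx Nx) Nx oW Wx); first exact: ip_smooth.
  by move=> z Wz Nz; apply: (K_isotropic K_perp Nz);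
    [exact: (kin m).2|exact: (kin j).2].
by rewrite (ip_sym (s x)); lra.
Qed.

Let Qsum (u : 'I_(mdim M) -> C V) :=
  \sum_(i : 'I_(mdim M) | (d <= i)%N) u i * Q i.

(** The {a, y_j} are the normal components of the symbol of [a]. Subtracting the [Q_j] with these
    coefficients leaves an element annihilating the [y_j], to which [tangent_decomposition] applies;
    its coefficients are then reduced modulo I. *)
Lemma deg2_decomposition a : hdeg 2 a -> exists u b,
  [/\ forall i, hdeg 0 (u i), lmon 2 b & J (a - (Qsum u + b))].
Proof.
move=> ha; pose u j := pb S a (fn C V (y j)).
have hu j : hdeg 0 (u j) by exact: (pb_hdeg S oV ha (hy j)).
have hQ : hdeg 2 (Qsum u).
  by apply: hdeg_bigsum => // i _; apply: hdegMl => //; exact: (adapted_Q adapt).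
have [j dj|b hb Jb] := tangent_decomposition (hdegB oV ha hQ).
  rewrite pbDl // pbNl // pb_suml // (bigD1 j) //= big1 ?addr0 => [|i /andP[di ij]].
    rewrite (pb_leibniz_l S oV (hu j) (adapted_Q adapt j) (hy j)).
    rewrite (adapted_Qy adapt) // eqxx mulr1 (pb_low S oV (hu j) (hy j)) //.
    by rewrite mul0r mulr0 addr0 subrr.
  rewrite (pb_leibniz_l S oV (hu i) (adapted_Q adapt i) (hy j)).
  rewrite (adapted_Qy adapt) // (negbTE ij) mulr0 (pb_low S oV (hu i) (hy j)) //.
  by rewrite mul0r mulr0 addr0.
have /choice[b' hb'] i : exists b', lmon 1 b' /\ J (b i - b').
  by have [b' ? ?] := deg1_decomposition (hb i); exists b'.
exists u, (\sum_i lE i * b' i); split => //.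
  by exists b' => // i; exact: (hb' i).1.
have -> : a - (Qsum u + \sum_i lE i * b' i) =
    (a - Qsum u - \sum_i lE i * b i) + \sum_i lE i * (b i - b' i).
  rewrite [X in _ = _ + X](eq_bigr _ (fun i _ => mulrBr _ _ _)) sumrB.
  by rewrite addrA subrK opprD addrA.
apply: gen_idealD => //; apply: gen_ideal_sum => i _.
by apply: gen_idealMl; exact: (hb' i).2.
Qed.

Lemma deg3_decomposition a : hdeg 3 a -> exists u b,
  [/\ forall i, lmon 1 (u i), lmon 3 b & J (a - (Qsum u + b))].
Proof.
move=> /(adapted_deg3 adapt)[n [v [h [hv hh ->]]]].
elim/big_ind: _ => [||i _].
- exists (fun=> 0), 0; split; [by move=> _; exact: lmon0|exact: lmon0|].
  rewrite /Qsum big1 ?addr0 ?subr0; first exact: gen_ideal0.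
  by move=> i _; rewrite mul0r.
- move=> a1 a2 [u1 [b1 [hu1 hb1 J1]]] [u2 [b2 [hu2 hb2 J2]]].
  exists (fun i => u1 i + u2 i), (b1 + b2); split.
  + by move=> i; exact: lmonD.
  + exact: lmonD.
  have -> : Qsum (fun i => u1 i + u2 i) = Qsum u1 + Qsum u2.
    by rewrite /Qsum -big_split; apply: eq_bigr => i _; rewrite mulrDl.
  by rewrite addrACA opprD addrACA; exact: gen_idealD.
have [al [f hf alE] Jal] := deg1_decomposition (hv i).
have hal : lmon 1 al by exists f.
have [u [be [hu hbe Jbe]]] := deg2_decomposition (hh i).
exists (fun j => u j * al), (al * be); split.
- by move=> j; exact: lmonMl.
- exists (fun j => f j * be).
    by move=> j; apply: lmonMl => //; exact: hf.
  by rewrite {1}alE mulr_suml; apply: eq_bigr => j _; rewrite mulrA.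
(* With v = [v i] and h = [h i], the error is (v - al) h + al (h - (Qsum u + be)), both terms being
   in the ideal. *)
have -> : Qsum (fun j => u j * al) + al * be = al * (Qsum u + be).
  rewrite mulrDr mulr_sumr; congr (_ + _); apply: eq_bigr => j _.
  by rewrite mulrA (hdeg0_comm oV (hu j) (lmon_hdeg hal)).
rewrite -(subrK (al * h i) (v i * h i)) -addrA -mulrBl -mulrBr.
apply: gen_idealD; first exact: (gen_idealMr oV (hh i)).
exact: gen_idealMl.
Qed.

(** {y_j, u_j Q_j} = -u_j puts the [u_j] in I. Then a - b is in I, so [b] inherits the iterated
    brackets of [a], and [lmon_ideal] applies to it. *)
Lemma deg3_ideal a : hdeg 3 a ->
  (forall j : 'I_(mdim M), (d <= j)%N -> J (pb S (fn C V (y j)) a)) ->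
  kbracket 3 a -> J a.
Proof.
move=> ha Jy ka; have [u [b [hu hb Jb]]] := deg3_decomposition ha.
have hu1 i : hdeg 1 (u i) by exact: (lmon_hdeg (hu i)).
have Ju (j : 'I_(mdim M)) : (d <= j)%N -> J (u j).
  move=> dj; have := gen_ideal_pb_fn (P := P) oV (sy j) (fun x => @y0 j x dj) Jb.
  move=> /(gen_idealD (gen_idealN (Jy j dj))).
  rewrite pbDr // pbNr // pbDr // (lmon_pb_fn (sy j) hb) addr0 addKr pb_sumr //.
  rewrite (bigD1 j) //= big1 ?addr0 => [|i /andP[di ij]].
    rewrite (pb_leibniz S oV (hy j) (hu1 j) (adapted_Q adapt j)).
    rewrite (pb_low S oV (hy j) (hu1 j)) // mul0r add0r expr0 mul1r.
    rewrite (pb_anti S oV (hy j) (adapted_Q adapt j)) expr0 mul1r.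
    by rewrite (adapted_Qy adapt) // eqxx mulrN mulr1 opprK.
  rewrite (pb_leibniz S oV (hy j) (hu1 i) (adapted_Q adapt i)).
  rewrite (pb_low S oV (hy j) (hu1 i)) // mul0r add0r expr0 mul1r.
  rewrite (pb_anti S oV (hy j) (adapted_Q adapt i)) expr0 mul1r.
  by rewrite (adapted_Qy adapt) // (negbTE ij) oppr0 mulr0.
have Jab : J (a - b).
  have -> : a - b = (a - (Qsum u + b)) + Qsum u by rewrite opprD addrAC addrA addrK.
  apply: gen_idealD => //; apply: gen_ideal_sum => i di.
  by apply: (gen_idealMr oV (adapted_Q adapt i)); exact: Ju.
have := @kbracketB 3 _ _ ka (ideal_kbracket 3 Jab).
rewrite opprB addrC subrK => kb.
by rewrite -(subrK b a); apply: gen_idealD => //; exact: lmon_ideal kb.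
Qed.

End AdaptedFrame.

(** * Degree 3 elements in local coordinates *)

Section LocalCoordinates.
Context {R : realType} {M : manifold R} (C : graded_sheaf M).
Implicit Types (U V : set M).

Lemma hdeg_prod V (I : Type) (r : seq I) (A : pred I) (D : I -> nat) (F : I -> C V) :
  open V -> (forall i, hdeg (D i) (F i)) ->
  hdeg (\sum_(i <- r | A i) D i)%N (\prod_(i <- r | A i) F i).
Proof.
move=> oV hF; elim: r => [|i r IH]; first by rewrite !big_nil; exact: hdeg_one.
by rewrite !big_cons; case: ifP => // _; exact: hdegM.
Qed.

Lemma hdeg_exp V k n (a : C V) : open V -> hdeg k a -> hdeg (k * n)%N (a ^+ n).
Proof.
move=> oV ha; elim: n => [|n IH]; first by rewrite muln0; exact: hdeg_one.
by rewrite exprS mulnS; exact: hdegM.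
Qed.

Lemma prod_deg1_split V (I : Type) (r : seq I) (A : pred I) (F : I -> C V) :
  open V -> (forall i, hdeg 1 (F i)) -> (0 < \sum_(i <- r | A i) 1)%N ->
  exists b h, [/\ hdeg 1 b, hdeg (\sum_(i <- r | A i) 1).-1 h &
                  \prod_(i <- r | A i) F i = b * h].
Proof.
move=> oV hF; elim: r => [|i r IH]; first by rewrite big_nil.
rewrite !big_cons; case: ifP => // _ _.
exists (F i), (\prod_(i <- r | A i) F i); split => //.
by rewrite add1n /=; exact: hdeg_prod.
Qed.

Lemma local_coords_res m1 m2 U V (xi : 'I_m1 -> C U) (p : 'I_m2 -> C U) :
  open U -> open V -> V `<=` U -> local_coords xi p ->
  local_coords (fun i => res V (xi i)) (fun j => res V (p j)).
Proof.
move=> oU oV VU [hxi hp coord]; split.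
- by move=> i; exact: res_hdeg.
- by move=> j; exact: res_hdeg.
move=> W k oW WV.
have E c : coord_expr (fun i => res V (xi i)) (fun j => res V (p j)) W (k := k) c =
    coord_expr xi p W c.
  apply: eq_bigr => I _; apply: eq_bigr => J _; congr (_ * (_ * _)).
    by apply: eq_bigr => i _; rewrite res_comp.
  by apply: eq_bigr => j _; rewrite res_comp.
have [gen free] := coord W k oW (subset_trans WV VU); split.
  by move=> a /gen[c [sc ->]]; exists c; rewrite E.
by move=> c sc; rewrite E; exact: free.
Qed.

(** The generators [p] have degree 2, so a monomial of degree 3 contains an odd number of factors
    [xi]; one of them is split off. *)
Lemma local_coords_deg3 m1 m2 U V (xi : 'I_m1 -> C U) (p : 'I_m2 -> C U) (a : C V) :
  open U -> open V -> V `<=` U -> local_coords xi p -> hdeg 3 a ->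
  exists n (b h : 'I_n -> C V),
    [/\ forall i, hdeg 1 (b i), forall i, hdeg 2 (h i) & a = \sum_i b i * h i].
Proof.
move=> oU oV VU [hxi hp coord] ha.
pose dec (a : C V) := exists n (b h : 'I_n -> C V),
  [/\ forall i, hdeg 1 (b i), forall i, hdeg 2 (h i) & a = \sum_i b i * h i].
have dec0 : dec 0.
  exists 0%N, (fun=> 0), (fun=> 0).
  by split => [[]|[]|] //; rewrite big_ord0.
have decD a1 a2 : dec a1 -> dec a2 -> dec (a1 + a2).
  move=> [n1 [b1 [h1 [hb1 hh1 ->]]]] [n2 [b2 [h2 [hb2 hh2 ->]]]].
  exists (n1 + n2)%N.
  exists (fun i : 'I_(n1 + n2) =>
    match fintype.split i with inl j => b1 j | inr j => b2 j end).
  exists (fun i : 'I_(n1 + n2) =>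
    match fintype.split i with inl j => h1 j | inr j => h2 j end).
  split; try by move=> i; case: (fintype.split i).
  rewrite big_split_ord /=; congr (_ + _); apply: eq_bigr => i _.
    by rewrite (unsplitK (inl i)).
  by rewrite (unsplitK (inr i)).
have [gen _] := coord V 3 oV VU.
have [c [sc ->]] := gen a ha.
apply: (big_ind dec) => // I _; apply: (big_ind dec) => // J /eqP IJ.
have hxiV i : hdeg 1 (res V (xi i)) by exact: res_hdeg.
have hpV j : hdeg (2 * J j)%N (res V (p j) ^+ J j).
  by apply: hdeg_exp => //; exact: res_hdeg.
have I_gt0 : (0 < \sum_(i in I) 1)%N.
  rewrite sum1_card lt0n; apply/eqP => I0.
  by move/(congr1 odd): IJ; rewrite I0 add0n oddM.
have [b [h [hb hh ->]]] := prod_deg1_split oV hxiV I_gt0.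
exists 1%N, (fun=> fn C V (c I J) * b).
exists (fun=> h * \prod_j res V (p j) ^+ J j); split.
- by move=> _; apply: hdegMl => //; exact: fn_hdeg.
- move=> _; have := hdegM oV hh (hdeg_prod (index_enum _) xpredT oV hpV).
  rewrite -big_distrr /= sum1_card in I_gt0 *.
  have -> : (#|I|.-1 + 2 * \sum_j J j)%N = 2%N.
    by move: IJ I_gt0; case: #|I| => //= m; rewrite addSn => -[->].
  by [].
- by rewrite big_ord1 !mulrA.
Qed.

End LocalCoordinates.

(** * Existence of adapted frames near points of N *)

Section ExistsAdapted.
Context {R : realType} {M : manifold R} (E : pe_bundle M).
Variables (N : set M) (K : forall x, set (E x)).
Arguments K : clear implicits.
Context {C : Nmanifold2 M} {S : symplectic C} (P : corresponds S E) (d q : nat).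
Implicit Types (U V W : set M).

(** Sections through dual vectors at x pair with the [k i] to the identity matrix at x. The matrix
    stays invertible nearby, and its inverse corrects the sections. *)
Lemma exists_dual_sections U (x : M) (k : 'I_q -> section E) : open U -> U x ->
  (forall i, smooth_sec U (k i)) ->
  (forall a : 'I_q -> R, \sum_i a i *: k i x = 0 -> forall i, a i = 0) ->
  exists V (l : 'I_q -> section E), [/\ open V, V x, V `<=` U,
    forall i, smooth_sec V (l i) &
    forall y, V y -> forall i j, ip (k i y) (l j y) = (i == j)%:R].
Proof.
move=> oU Ux sk /exists_dual_vectors[u ku].
have [i0 ix] := @tdom_cover _ _ E x.
have /choice[s hs] j : exists s : section E, smooth_sec (@tdom _ _ E i0) s /\ s x = u j.
  by have [s ? ?] := exists_section_through (u j) ix; exists s.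
pose U1 := U `&` @tdom _ _ E i0.
have oU1 : open U1 by apply: openI => //; exact: tdom_open.
pose A y := \matrix_(i < q, j < q) ip (k i y) (s j y).
have sA : smooth_mx U1 A.
  move=> i j; have : smooth_on U1 (fun y => ip (k i y) (s j y)).
    apply: ip_smooth => //; first by apply: smooth_sec_sub (sk i) => y [].
    by apply: smooth_sec_sub (hs j).1 => y [].
  by apply: smooth_on_congr => // y _; rewrite mxE.
have Ax : A x = 1%:M.
  by apply/matrixP => i j; rewrite !mxE (hs j).2 ku.
have uA : A x \in unitmx by rewrite Ax unitmx1.
have [V [B [oV Vx VU sB AB]]] := smooth_inverse oU1 (conj Ux ix) sA uA.
exists V, (fun j => sec_lin (index_enum 'I_q) (fun m y => B y m j) s); split => //.
- by move=> y /VU[].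
- move=> j; apply: smooth_sec_lin => // m.
  by apply: smooth_sec_sub (hs m).1 => y /VU[].
- move=> y Vy i j; have /matrixP/(_ i j) := AB y Vy; rewrite !mxE => <-.
  by rewrite /sec_lin ip_sumr; apply: eq_bigr => m _; rewrite ipZr mxE mulrC.
Qed.

(** Full rank of the block {p, x} gives combinations of the [p], with constant coefficients, of any
    prescribed symbol at x. The brackets with the coordinates then form the identity matrix at x,
    and the inverse matrix makes the relations exact nearby. *)
Lemma exists_tangent_frame U (x : M) (c : chart R M (mdim M)) : open U -> U x ->
  admissible c -> cdom c x -> exists V (Z : 'I_(mdim M) -> C V),
  [/\ open V, V x, V `<=` U `&` cdom c, forall i, hdeg 2 (Z i) &
   forall i j, pb S (Z i) (fn C V (fun y => cmap c y ord0 j)) = (i == j)%:R].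
Proof.
move=> oU Ux adm cx.
have [c0 ac0 c0x] := atlas_cover x.
have [U0 [xi [p [oU0 U0x coord0]]]] := nlocal C x.
pose W := U `&` U0 `&` (cdom c `&` cdom c0).
have oW : open W by do !apply: openI => //; exact: cdom_open.
have Wx : W x by [].
have WU0 : W `<=` U0 by move=> y [[]].
have WU : W `<=` U by move=> y [[]].
have Wc : W `<=` cdom c by move=> y [_ []].
have Wc0 : W `<=` cdom c0 by move=> y [_ []].
have coord := local_coords_res oU0 oW WU0 coord0.
have sc0 j : smooth_on W (fun y => cmap c0 y ord0 j).
  apply: smooth_on_sub Wc0 _; apply: smooth_on_coord; exact: atlas_admissible.
have sc j : smooth_on W (fun y => cmap c y ord0 j).
  by apply: smooth_on_sub Wc _; exact: smooth_on_coord.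
have hxi i : hdeg 1 (res W (xi i)) by case: coord.
have hp i : hdeg 2 (res W (p i)) by case: coord.
have /choice[G hG] i : exists g : _ -> M -> R, forall j, smooth_on W (g j) /\
    pb S (res W (xi i)) (res W (xi j)) = fn C W (g j).
  have /choice[g hg] j : exists gj : M -> R, smooth_on W gj /\
      pb S (res W (xi i)) (res W (xi j)) = fn C W gj.
    have h0 : hdeg 0 (pb S (res W (xi i)) (res W (xi j))).
      exact: (pb_hdeg S oW (hxi i) (hxi j)).
    by have [g sg gE] := fn_onto oW h0; exists g.
  by exists g.
have /choice[H hH] i : exists g : _ -> M -> R, forall j, smooth_on W (g j) /\
    pb S (res W (p i)) (fn C W (fun y => cmap c0 y ord0 j)) = fn C W (g j).
  have /choice[g hg] j : exists gj : M -> R, smooth_on W gj /\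
      pb S (res W (p i)) (fn C W (fun y => cmap c0 y ord0 j)) = fn C W gj.
    have h0 : hdeg 0 (pb S (res W (p i)) (fn C W (fun y => cmap c0 y ord0 j))).
      exact: (pb_hdeg S oW (hp i) (fn_hdeg C oW (sc0 j))).
    by have [g sg gE] := fn_onto oW h0; exists g.
  by exists g.
have [_ /andP[_ /row_fullP[B BH]]] := pb_nondeg oW coord ac0 Wc0
  (fun i j => (hG i j).1) (fun i j => (hH i j).1)
  (fun i j => (hG i j).2) (fun i j => (hH i j).2) Wx.
have /choice[w hw] a := coordinate_vector a ac0 adm c0x cx.
(* [B] is a left inverse of the matrix of [H] at x, so z a times that matrix is w a: the symbol of
   [Z a] at x is the a-th coordinate vector of [c]. *)
pose z a := w a *m B.
pose Z a := \sum_i fn C W (fun=> z a ord0 i) * res W (p i).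
have hz a i : hdeg 0 (fn C W (fun=> z a ord0 i)).
  by apply: fn_hdeg => //; exact: smooth_on_cst.
have hZ a : hdeg 2 (Z a) by apply: hdeg_bigsum => // i _; exact: hdegMl.
have /choice[g hg] a : exists g : _ -> M -> R, forall b,
    [/\ smooth_on W (g b), g b x = (a == b)%:R &
        pb S (Z a) (fn C W (fun y => cmap c y ord0 b)) = fn C W (g b)].
  have [X [D [atX ZE]]] := ati_onto P oW (hZ a).
  exists (fun b => X (fun y => cmap c y ord0 b)) => b; split.
  - exact: (atiyah_smooth oW atX (sc b)).
  - have [c1 [w1 [ac1 c1x dir1]]] := atX.1.1 x Wx.
    have := directional_transfer ac1 (atlas_admissible ac0) c1x c0x dir1.
    rewrite (_ : \row_j _ = w a); last first.
      apply/rowP => j; rewrite mxE.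
      have : fn C W (X (fun y => cmap c0 y ord0 j)) =
             fn C W (fun y => \sum_i z a ord0 i * H i j y).
        rewrite -(pb_ati_fn P oW atX (sc0 j)) -ZE /Z pb_suml // fn_sum //.
          apply: eq_bigr => i _; rewrite pbZl // (hH i j).2 fnM //.
            exact: smooth_on_cst.
          exact: (hH i j).1.
        move=> i; apply: smooth_onM => //; first exact: smooth_on_cst.
        exact: (hH i j).1.
      move=> /(fn_eq C oW) e; rewrite e //.
      + have -> : w a = z a *m (\matrix_(i, j) H i j x).
          by rewrite /z -mulmxA BH mulmx1.
        by rewrite mxE; apply: eq_bigr => i _; rewrite !mxE.
      + exact: (atiyah_smooth oW atX (sc0 j)).
      + apply: smooth_on_sum => // i; apply: smooth_onM => //.
          exact: smooth_on_cst.
        exact: (hH i j).1.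
    move=> dir; rewrite (dir _ _ oW Wx (sc b)); exact: hw.
  - by rewrite ZE pb_ati_fn.
pose A y := \matrix_(a, b) g a b y.
have sA : smooth_mx W A.
  move=> a b; have [s1 _ _] := hg a b.
  by apply: smooth_on_congr s1 => // y _; rewrite mxE.
have Ax : A x = 1%:M.
  by apply/matrixP => a b; rewrite !mxE; have [_ -> _] := hg a b.
have uA : A x \in unitmx by rewrite Ax unitmx1.
have [V [B' [oV Vx VW sB AB]]] := smooth_inverse oW Wx sA uA.
exists V, (fun a => \sum_m fn C V (fun y => B' y a m) * res V (Z m)); split => //.
- by move=> y /VW[[Uy _] [cy _]].
- move=> a; apply: hdeg_bigsum => // m _; apply: hdegMl => //.
    exact: fn_hdeg.
  exact: res_hdeg.
move=> a b; rewrite pb_suml //.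
have scV : smooth_on V (fun y => cmap c y ord0 b) by exact: smooth_on_sub (sc b).
have sg m : smooth_on V (g m b) by have [s1 _ _] := hg m b; exact: smooth_on_sub s1.
have E1 m : pb S (fn C V (fun y => B' y a m) * res V (Z m))
    (fn C V (fun y => cmap c y ord0 b)) = fn C V (fun y => B' y a m * g m b y).
  have hB := fn_hdeg C oV (sB a m).
  rewrite (pb_leibniz_l S oV hB (res_hdeg oW oV VW (hZ m)) (fn_hdeg C oV scV)).
  rewrite (pb_low S oV hB (fn_hdeg C oV scV)) // mul0r mulr0 addr0.
  rewrite -(res_fn C oW oV VW (sc b)) -res_pb // fnM //; congr (_ * _).
  by have [s1 _ ->] := hg m b; rewrite res_fn.
rewrite (eq_bigr _ (fun m _ => E1 m)) -fn_sum => // [|m]; last exact: smooth_onM.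
rewrite -fn_natr //; apply: fn_congr => //.
  by apply: smooth_on_sum => // m; exact: smooth_onM.
(* [smooth_inverse] provides a right inverse, while the coefficients act on the left. *)
move=> y Vy; have /matrixP/(_ a b) := mulmx1C (AB y Vy); rewrite !mxE => <-.
by apply: eq_bigr => m _; rewrite mxE.
Qed.

Lemma exists_adapted U (x : M) : submanifold N d -> subbundle N K q ->
  open U -> U x -> N x -> exists V k l c (Q : 'I_(mdim M) -> C V),
  [/\ open V, V x, V `<=` U & @adapted R M E N K C S d q V k l c Q].
Proof.
move=> [_ /(_ x)slN] /(_ x)hK oU Ux Nx.
have [U1 [k [oU1 U1x sk hk]]] := hK Nx.
have [free _] := hk x U1x Nx.
have [c sc cx] := slN Nx.
have [U2 [l [oU2 U2x U21 sl dual]]] := exists_dual_sections oU1 U1x sk free.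
have [U0 [xi [p [oU0 U0x coord0]]]] := nlocal C x.
pose W := U `&` U2 `&` U0.
have oW : open W by do !apply: openI.
have Wx : W x by [].
have [V [Q [oV Vx VW hQ Qy]]] := exists_tangent_frame oW Wx sc.1 cx.
have VU2 : V `<=` U2 by move=> y /VW[[[]]].
have VU1 : V `<=` U1 by move=> y /VU2; exact: U21.
have VU0 : V `<=` U0 by move=> y /VW[[[]]].
exists V, k, l, c, Q; split => //; first by move=> y /VW[[[]]].
split => //.
- move=> i; split; first exact: smooth_sec_sub (sk i).
  move=> y Vy Ny; apply/(hk y (VU1 y Vy) Ny).2.
  exists (fun j => (j == i)%:R); rewrite (bigD1 i) //= eqxx scale1r big1 ?addr0 //.
  by move=> j /negbTE ->; rewrite scale0r.
- by move=> y Vy Ny u /(hk y (VU1 y Vy) Ny).2.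
- by move=> i; exact: smooth_sec_sub (sl i).
- by move=> y Vy; apply: dual; exact: VU2.
- by move=> y /VW[].
- by move=> a; exact: local_coords_deg3 coord0.
Qed.

End ExistsAdapted.

(** * Reducible Courant functions *)

Section Reducibility.
Context {R : realType} {M : manifold R} {C : Nmanifold2 M} {S : symplectic C}.
Context {E : pe_bundle M} (P : corresponds S E) (N : set M) (d q : nat).
Variables (hN : submanifold N d) (K : forall x, set (E x)).
Arguments K : clear implicits.
Hypothesis K_sub : subbundle N K q.
Hypothesis K_perp : forall x, N x -> forall u : E x,
  K x u <-> forall v, K x v -> ip u v = 0.
Variable Theta : C setT.
Hypothesis Theta3 : hdeg 3 Theta.
Variables (rho : forall x, E x -> (M -> R) -> R).
Variables (br : section E -> section E -> section E).
Hypothesis courant : Courant_structure_of P Theta rho br.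
Implicit Types (U V W : set M).
Local Notation J := (gen_ideal N K P d).

Let oT : open [set: M] := openT.
Let subT V : V `<=` [set: M] := @subsetT _ V.
Let th V := res V Theta.
Let hth V : open V -> hdeg 3 (th V).
Proof. by move=> oV; exact: res_hdeg. Qed.

Lemma extend_fn V (x : M) f : open V -> V x -> smooth_on V f -> exists F W,
  [/\ smooth_on setT F, open W, W x, W `<=` V & forall y, W y -> F y = f y].
Proof.
move=> oV Vx sf.
have [chi [Z [schi chi1 oO chi0 VO]]] := exists_cutoff oV Vx.
have NV : \forall y \near x, V y by exact: open_nbhs_nbhs.
have [W [oW Wx] WP] := @near_open M x _ (filterI chi1 NV).
exists (fun y => chi y * f y), W; split => //.
- exact: smooth_on_extend oV oO schi chi0 VO sf.
- by move=> y /WP[].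
- by move=> y /WP[c1 _]; rewrite c1 mul1r.
Qed.

Lemma extend_sec V (x : M) s : open V -> V x -> smooth_sec V s -> exists e W,
  [/\ smooth_sec setT e, section_in N K V s -> section_in N K setT e,
      open W /\ W x, W `<=` V & forall y, W y -> e y = s y].
Proof.
move=> oV Vx ss.
have [chi [Z [schi chi1 oO chi0 VO]]] := exists_cutoff oV Vx.
have NV : \forall y \near x, V y by exact: open_nbhs_nbhs.
have [W [oW Wx] WP] := @near_open M x _ (filterI chi1 NV).
have se := smooth_sec_extend oV oO schi chi0 VO ss.
exists (secZ chi s), W; split => //.
- move=> [_ sK]; split => // y _ Ny; case: (VO y) => [Vy|Oy].
    by rewrite /secZ; apply: (K_Z K_perp _ Ny); exact: sK.
  by rewrite /secZ chi0 // scale0r; exact: (K_0 K_perp Ny).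
- by move=> y /WP[].
- by move=> y /WP[c1 _]; rewrite /secZ c1 scale1r.
Qed.

Lemma exists_section_in U (x : M) u : open U -> U x -> N x -> K x u ->
  exists V s, [/\ open V, V x, V `<=` U, section_in N K V s & s x = u].
Proof.
move=> oU Ux Nx; have [U1 [k [oU1 U1x sk hk]]] := K_sub Nx.
move=> /(hk x U1x Nx).2[a ->].
exists (U `&` U1), (sec_lin (index_enum _) (fun i _ => a i) k); split => //.
- exact: openI.
- split.
    apply: smooth_sec_lin => [|i|i]; first exact: openI.
      exact: smooth_on_cst.
    by apply: smooth_sec_sub (sk i) => y [].
  by move=> y [_ U1y] Ny; apply/(hk y U1y Ny).2; exists a.
Qed.

Lemma tangent_germ (x : M) v W f g : tangent_vector x v -> open W -> W x ->
  smooth_on W f -> smooth_on W g -> (forall y, W y -> f y = g y) -> v f = v g.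
Proof.
move=> [c [w [ac cx dir]]] oW Wx sf sg fg.
rewrite (dir W f oW Wx sf) (dir W g oW Wx sg).
apply: near_eq_derive; have := near_chart_image oW Wx cx.
by apply: filterS => _ [z [Wz cz] <-]; rewrite /= cmapK // fg.
Qed.

(** The anchor formula concerns global objects: [s] and [f] are replaced by global ones that agree
    with them near x, and the two sides are compared over that neighbourhood. *)
Lemma anchor_value V s f g (x : M) : open V -> smooth_sec V s -> smooth_on V f ->
  smooth_on V g -> pb S (pb S (th V) (sec P V s)) (fn C V f) = fn C V g ->
  V x -> g x = rho (s x) f.
Proof.
move=> oV ss sf sg E1 Vx; have [[tv _ brho] anchor _ _] := courant.
have [e [W1 [se _ [oW1 W1x] W1V es]]] := extend_sec oV Vx ss.
have [F [W [sF oW Wx WW1 Ff]]] := extend_fn oW1 W1x (smooth_on_sub W1V sf).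
have WV : W `<=` V by exact: subset_trans W1V.
have sFW : smooth_on W F by exact: smooth_on_sub sF.
have sg1 : smooth_on setT (fun y => rho (e y) F) by exact: brho.
have : fn C W g = fn C W (fun y => rho (e y) F).
  rewrite -(res_fn C oV oW WV sg) -E1 -(res_fn C oT oW (@subT W) sg1).
  rewrite anchor // !res_pb // /th res_comp // res_sec // res_fn //.
  rewrite res_sec // res_fn //; congr (pb S (pb S _ _) _).
    apply: sec_congr => //; first exact: smooth_sec_sub ss.
    by move=> y Wy; rewrite es //; exact: WW1.
  by apply: fn_congr => // [|y Wy]; [exact: smooth_on_sub sf|rewrite Ff].
move=> /(fn_eq C oW (smooth_on_sub WV sg) (smooth_on_sub (@subT W) sg1)) -> //.
rewrite es; last exact: WW1.
apply: (tangent_germ (tv _ _) oW Wx) => //; exact: smooth_on_sub sf.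
Qed.

Lemma bracket_value V s t u (x : M) : open V ->
  (forall e1 e2, section_in N K setT e1 -> section_in N K setT e2 ->
     section_in N K setT (br e1 e2)) ->
  section_in N K V s -> section_in N K V t -> smooth_sec V u ->
  pb S (pb S (th V) (sec P V s)) (sec P V t) = sec P V u ->
  V x -> N x -> K x (u x).
Proof.
move=> oV brK sin tin su E1 Vx Nx; have [_ _ sbr bracket] := courant.
have [e1 [W1 [se1 e1K [oW1 W1x] W1V es]]] := extend_sec oV Vx sin.1.
have [tin1 tin2] := tin.
(* Extending from [W1] rather than from [V] makes both global sections agree with the given ones
   over the same [W]. *)
have [e2 [W [se2 e2K [oW Wx] WW1 et]]] := extend_sec oW1 W1x (smooth_sec_sub W1V tin1).
have WV : W `<=` V by exact: subset_trans W1V.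
have e1in := e1K sin.
have e2in : section_in N K setT e2.
  apply: e2K; split; first exact: smooth_sec_sub tin1.
  by move=> y /W1V; exact: tin2.
have sb := sbr e1 e2 se1 se2.
have : sec P W u = sec P W (br e1 e2).
  rewrite -(res_sec P oV oW WV su) -E1 -(res_sec P oT oW (@subT W) sb).
  rewrite bracket // !res_pb // /th res_comp // !res_sec //; last exact: sin.1.
  congr (pb S (pb S _ _) _).
    apply: sec_congr => //; first exact: smooth_sec_sub sin.1.
    by move=> y Wy; rewrite es //; exact: WW1.
  by apply: sec_congr => // [|y Wy]; [exact: smooth_sec_sub tin1|rewrite et].
move=> /(sec_eq P oW (smooth_sec_sub WV su) (smooth_sec_sub (@subT W) sb)) -> //.
exact: (brK e1 e2 e1in e2in).2.
Qed.

(** Jacobi identity with {f, s} = 0. It says that <{Theta, f}, s> = rho(s) f, so {Theta, f} is the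
    differential of [f] transported by the adjoint of the anchor. *)
Lemma pb_fn_sec_swap V f s : open V -> smooth_on V f -> smooth_sec V s ->
  pb S (pb S (th V) (fn C V f)) (sec P V s) =
  pb S (pb S (th V) (sec P V s)) (fn C V f).
Proof.
move=> oV sf ss; have [hf hs] := (fn_hdeg C oV sf, sec_hdeg P oV ss).
have hths : hdeg 2 (pb S (th V) (sec P V s)) by exact: (pb_hdeg S oV (hth oV) hs).
have := pb_jacobi S oV (hth oV) hf hs.
rewrite (pb_low S oV hf hs) // pb0r // expr0 mul1r => /esym/eqP.
rewrite addr_eq0 => /eqP ->.
by rewrite (pb_anti S oV hf hths) expr0 mul1r opprK.
Qed.

(** * From the conditions on the anchor and the bracket to reducibility *)

Section Sufficiency.
Hypothesis rhoK : forall x (u : E x), N x -> K x u -> tangent_to N d x (rho u).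
Hypothesis brK : forall e1 e2, section_in N K setT e1 ->
  section_in N K setT e2 -> section_in N K setT (br e1 e2).

(** Along N the section {Theta, f} pairs with v in K to rho(v) f = 0, so it lies in K^perp = K. *)
Lemma pb_Theta_ideal0 V f : open V -> smooth_on V f ->
  (forall x, V x -> N x -> f x = 0) ->
  exists2 t, section_in N K V t & pb S (th V) (fn C V f) = sec P V t.
Proof.
move=> oV sf f0.
have h1 : hdeg 1 (pb S (th V) (fn C V f)).
  exact: (pb_hdeg S oV (hth oV) (fn_hdeg C oV sf)).
have [t st tE] := sec_onto P oV h1.
exists t => //; split => // x Vx Nx; apply/(K_perp Nx) => v Kv.
have [W [s [oW Wx WV sin sx]]] := exists_section_in oV Vx Nx Kv.
have stW := smooth_sec_sub WV st; have sfW := smooth_on_sub WV sf.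
have sg : smooth_on W (fun y => ip (t y) (s y)) by apply: ip_smooth => //; exact: sin.1.
rewrite -sx (anchor_value (g := fun y => ip (t y) (s y)) oW sin.1 sfW sg) //.
  apply: (tangent_to_vanishing _ Nx oV Vx sf f0).
  by apply: rhoK => //; exact: sin.2.
rewrite -pb_fn_sec_swap //; last exact: sin.1.
rewrite -(pb_sec_sec P oW stW sin.1); congr (pb S _ _).
by rewrite -(res_sec P oV oW WV st) -tE res_pb // /th res_comp // res_fn.
Qed.

(** {Theta, s} represents the pair (rho(s), [[s, .]]), and the hypotheses on rho and on the bracket
    match the two conditions defining I_2. *)
Lemma pb_Theta_ideal1 V s : open V -> section_in N K V s -> exists X D,
  [/\ atiyah V X D, (forall x, V x -> N x -> tangent_to N d x (fun f => X f x)),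
    (forall W t, open W -> W `<=` V -> section_in N K W t -> section_in N K W (D t)) &
    pb S (th V) (sec P V s) = ati P V X D].
Proof.
move=> oV sin; have [ss sK] := sin.
have h2 : hdeg 2 (pb S (th V) (sec P V s)).
  exact: (pb_hdeg S oV (hth oV) (sec_hdeg P oV ss)).
have [X [D [atX XE]]] := ati_onto P oV h2.
have thW W : open W -> W `<=` V -> pb S (th W) (sec P W s) = ati P W X D.
  move=> oW WV; rewrite -(res_ati P oV oW WV atX) -XE res_pb // /th res_comp //.
  by rewrite res_sec.
exists X, D; split => //.
- move=> x Vx Nx; have [c [w [sc cx w0 dir]]] := rhoK Nx (sK x Vx Nx).
  (* [f] is smooth on [U] only and the operator lives over [V], hence the intersection. *)
  exists c, w; split => // U f oU Ux sf; rewrite -(dir U f oU Ux sf).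
  have oW : open (U `&` V) by exact: openI.
  have WV : U `&` V `<=` V by move=> y [].
  have sfW : smooth_on (U `&` V) f by apply: smooth_on_sub sf => y [].
  have atW := atiyah_sub WV atX.
  apply: (@anchor_value (U `&` V) s f (X f)) => //.
  + exact: smooth_sec_sub ss.
  + exact: (atiyah_smooth oW atW sfW).
  + by rewrite thW // pb_ati_fn.
- move=> W t oW WV tin; have atW := atiyah_sub WV atX.
  have sDt : smooth_sec W (D t) by exact: (atiyah_smooth_sec oW atW tin.1).
  split => // x Wx Nx.
  have sinW : section_in N K W s.
    by split; [exact: smooth_sec_sub ss|move=> y /WV; exact: sK].
  apply: (bracket_value oW brK sinW tin sDt _ Wx Nx).
  by rewrite thW // pb_ati_sec //; exact: tin.1.
Qed.

(** The representative (Y, B) from [ati_onto] is already a section of the Atiyah algebroid; the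
    Jacobi identity computes its action as a commutator, and commutators preserve the conditions
    defining I_2. *)
Lemma pb_ideal2 V X D X' D' : open V -> atiyah V X D -> atiyah V X' D' ->
  (forall x, V x -> N x -> tangent_to N d x (fun f => X f x)) ->
  (forall x, V x -> N x -> tangent_to N d x (fun f => X' f x)) ->
  (forall W s, open W -> W `<=` V -> section_in N K W s -> section_in N K W (D s)) ->
  (forall W s, open W -> W `<=` V -> section_in N K W s -> section_in N K W (D' s)) ->
  ideal_gen N K P d (pb S (ati P V X D) (ati P V X' D')).
Proof.
move=> oV at1 at2 t1 t2 D1 D2.
have [h1 h2] := (ati_hdeg P oV at1, ati_hdeg P oV at2).
have h3 : hdeg 2 (pb S (ati P V X D) (ati P V X' D')) by exact: (pb_hdeg S oV h1 h2).
have [Y [B [atY YE]]] := ati_onto P oV h3.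
have jac W k (a : C W) : open W -> W `<=` V -> hdeg k a ->
    pb S (ati P W Y B) a = pb S (ati P W X D) (pb S (ati P W X' D') a)
      - pb S (ati P W X' D') (pb S (ati P W X D) a).
  move=> oW WV ha.
  have a1 := atiyah_sub WV at1; have a2 := atiyah_sub WV at2.
  rewrite (pb_jacobi S oW (ati_hdeg P oW a1) (ati_hdeg P oW a2) ha).
  rewrite -signr_odd expr0 mul1r addrK.
  by rewrite -(res_ati P oV oW WV atY) -YE res_pb // !res_ati.
rewrite YE; apply: Ideal2 => //.
- move=> x Vx Nx; have [c sc cx] := hN.2 x Nx.
  apply: (tangent_to_slice sc cx); first exact: atY.1.1.
  move=> j dj; have oW : open (V `&` cdom c) by apply: openI => //; exact: cdom_open.
  have WV : V `&` cdom c `<=` V by move=> y [].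
  have a1 := atiyah_sub WV at1; have a2 := atiyah_sub WV at2.
  have aY := atiyah_sub WV atY.
  pose y z := cmap c z ord0 j.
  have sy : smooth_on (V `&` cdom c) y.
    apply: (@smooth_on_sub _ _ (cdom c)) => [z []//|].
    by apply: smooth_on_coord; case: sc.
  have y0 z : (V `&` cdom c) z -> N z -> y z = 0.
    by move=> [_ cz] Nz; have := (sc.2 z cz).1 Nz; apply.
  have sXy := atiyah_smooth oW a1 sy; have sX'y := atiyah_smooth oW a2 sy.
  have X0 z : (V `&` cdom c) z -> N z -> X y z = 0.
    by move=> Wz Nz; exact: (tangent_to_vanishing (t1 z (WV z Wz) Nz) Nz oW Wz).
  have X'0 z : (V `&` cdom c) z -> N z -> X' y z = 0.
    by move=> Wz Nz; exact: (tangent_to_vanishing (t2 z (WV z Wz) Nz) Nz oW Wz).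
  have Wx : (V `&` cdom c) x by [].
  have : fn C (V `&` cdom c) (Y y) =
      fn C (V `&` cdom c) (fun z => X (X' y) z + - X' (X y) z).
    rewrite -(pb_ati_fn P oW aY sy) (jac _ 0%N) //; last exact: fn_hdeg.
    rewrite !pb_ati_fn // fnD ?fnN //; [exact: (atiyah_smooth oW a2)|
      exact: (atiyah_smooth oW a1)|].
    by apply: smooth_onN => //; exact: (atiyah_smooth oW a2).
  move=> /(fn_eq C oW) e; rewrite -/y e //.
  + rewrite (tangent_to_vanishing (t1 x Vx Nx) Nx oW Wx sX'y X'0).
    by rewrite (tangent_to_vanishing (t2 x Vx Nx) Nx oW Wx sXy X0) subr0.
  + exact: (atiyah_smooth oW aY).
  + apply: smooth_onD => //; first exact: (atiyah_smooth oW a1).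
    by apply: smooth_onN => //; exact: (atiyah_smooth oW a2).
- move=> W s oW WV sin.
  have a1 := atiyah_sub WV at1; have a2 := atiyah_sub WV at2.
  have aY := atiyah_sub WV atY.
  have [s1 K1] := D1 W _ oW WV (D2 W s oW WV sin).
  have [s2 K2] := D2 W _ oW WV (D1 W s oW WV sin).
  have sBs : smooth_sec W (B s) by exact: (atiyah_smooth_sec oW aY sin.1).
  have c1 := smooth_on_cst W (-1 : R).
  have s3 : smooth_sec W (secZ (fun=> -1) (D' (D s))) by exact: smooth_secZ.
  have s4 : smooth_sec W (secD (D (D' s)) (secZ (fun=> -1) (D' (D s)))).
    exact: smooth_secD.
  have : sec P W (B s) = sec P W (secD (D (D' s)) (secZ (fun=> -1) (D' (D s)))).
    rewrite -(pb_ati_sec P oW aY sin.1) (jac _ 1%N) //;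
      last exact: (sec_hdeg P oW sin.1).
    rewrite !pb_ati_sec //; try exact: sin.1;
      [|exact: (D1 W s oW WV sin).1|exact: (D2 W s oW WV sin).1].
    by rewrite sec_add // sec_scale // fnN ?fn1 ?mulN1r //; exact: smooth_on_cst.
  move=> /(sec_eq P oW sBs s4) e; split => // x Wx Nx; rewrite e //.
  apply: (K_D K_perp Nx); first exact: K1.
  by apply: (K_Z K_perp _ Nx); exact: K2.
Qed.

(** Membership of the germ at x. It is needed because the neighbourhood found for a generator of
    degree 2 depends on that generator. *)
Let ideal_at V (x : M) (a : C V) :=
  exists W, [/\ open W, W x, W `<=` V & J (res W a)].

Let ideal_atD V x (a b : C V) : open V -> ideal_at x a -> ideal_at x b ->
  ideal_at x (a + b).
Proof.
move=> oV [W1 [oW1 W1x W1V J1]] [W2 [oW2 W2x W2V J2]].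
have oW : open (W1 `&` W2) by exact: openI.
have WW1 : W1 `&` W2 `<=` W1 by move=> y [].
have WW2 : W1 `&` W2 `<=` W2 by move=> y [].
have WV : W1 `&` W2 `<=` V by exact: subset_trans W1V.
exists (W1 `&` W2); split => //; rewrite resD //; apply: gen_idealD.
  by rewrite -(res_comp _ oV oW1 oW W1V WW1); exact: gen_ideal_res.
by rewrite -(res_comp _ oV oW2 oW W2V WW2); exact: gen_ideal_res.
Qed.

Let ideal_at_gen V x (a : C V) : open V -> V x -> J a -> ideal_at x a.
Proof. by move=> oV Vx Ja; exists V; split => //; rewrite res_id. Qed.

Let ideal_at_Ml V x (a b : C V) : open V -> ideal_at x a -> ideal_at x (b * a).
Proof.
move=> oV [W [oW Wx WV JW]]; exists W; split => //.
by rewrite resM //; exact: gen_idealMl.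
Qed.

(** For g = y_j or k_i, the Jacobi identity turns {g, {Theta, h}} into {{g, Theta}, h} and {Theta,
    {g, h}} up to signs, both controlled by the results on I_0, I_1 and {I_2, I_2}. *)
Lemma pb_Theta_ideal2 V X D (x : M) : open V -> V x -> N x -> atiyah V X D ->
  (forall x, V x -> N x -> tangent_to N d x (fun f => X f x)) ->
  (forall W s, open W -> W `<=` V -> section_in N K W s -> section_in N K W (D s)) ->
  ideal_at x (pb S (th V) (ati P V X D)).
Proof.
move=> oV Vx Nx atX tX tD.
have [W [k [l [c [Q [oW Wx WV ad]]]]]] := exists_adapted P hN K_sub oV Vx Nx.
exists W; split => //.
have atW := atiyah_sub WV atX.
have tW y : W y -> N y -> tangent_to N d y (fun f => X f y) by move=> /WV; exact: tX.
have tDW W' s : open W' -> W' `<=` W -> section_in N K W' s -> section_in N K W' (D s).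
  by move=> oW' W'W; apply: tD => //; exact: subset_trans WV.
rewrite res_pb // /th res_comp // res_ati //.
have ha := ati_hdeg P oW atW; have ht := hth oW; rewrite /th in ht.
apply: (deg3_ideal (P := P) K_perp oW ad); first exact: (pb_hdeg S oW ht ha).
- move=> j dj.
  have sy : smooth_on W (fun z => cmap c z ord0 j).
    apply: smooth_on_sub (adapted_dom ad) _; apply: smooth_on_coord.
    by case: (adapted_slice ad).
  have y0 z : W z -> N z -> cmap c z ord0 j = 0.
    move=> Wz Nz; have [_ sl0] := adapted_slice ad.
    by have := (sl0 z (adapted_dom ad Wz)).1 Nz; apply.
  have hy := fn_hdeg C oW sy.
  rewrite (pb_jacobi S oW hy ht ha) mul0n expr0 mul1r.
  apply: gen_idealD.
    rewrite (pb_anti S oW hy ht) mul0n expr0 mul1r pbNl //; apply: gen_idealN.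
    have [t tin ->] := pb_Theta_ideal0 oW sy y0.
    apply: gen_ideal_pb_sec => //; apply: gen_ideal_gen; exact: Ideal2.
  rewrite (pb_anti S oW hy ha) mul0n expr0 mul1r pbNr // pb_ati_fn //.
  apply: gen_idealN.
  have [||t tin ->] := @pb_Theta_ideal0 W (X (fun z => cmap c z ord0 j)) oW.
  + exact: (atiyah_smooth oW atW sy).
  + by move=> z Wz Nz; exact: (tangent_to_vanishing (tW z Wz Nz) Nz oW Wz sy y0).
  + by apply: gen_ideal_gen; exact: Ideal1.
(* A single bracket with [k_i] already lies in the ideal; the two remaining ones preserve it. *)
move=> i; apply: (ideal_kbracket K_perp oW ad).
have kin := adapted_k ad i; have hk := sec_hdeg P oW kin.1.
rewrite (pb_jacobi S oW hk ht ha); apply: gen_idealD.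
  rewrite (pb_anti S oW hk ht) pbNl //; apply: gen_idealN.
  rewrite -signr_odd expr1 mulN1r pbNl //; apply: gen_idealN.
  have [X' [D' [atX' tX' tD' ->]]] := pb_Theta_ideal1 oW kin.
  by apply: gen_ideal_gen; exact: pb_ideal2.
apply: gen_idealMl; rewrite (pb_anti S oW hk ha) pbNr //; apply: gen_idealN.
rewrite -signr_odd expr0 mul1r pb_ati_sec //; last exact: kin.1.
have Dkin := tDW W (k i) oW (@subset_refl _ _) kin.
have [X' [D' [atX' tX' tD' ->]]] := pb_Theta_ideal1 oW Dkin.
by apply: gen_ideal_gen; exact: Ideal2.
Qed.

Lemma reducible_sufficient : reducible N K P d Theta.
Proof.
move=> U a oU va x Ux Nx.
have [V [oV Vx VU Ja]] := va x Ux Nx.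
suff [W [oW Wx WV JW]] : ideal_at x (pb S (th V) (res V a)).
  have WU : W `<=` U by exact: subset_trans VU.
  exists W; split => //.
  by move: JW; rewrite !res_pb // /th !res_comp.
have [I [b [g [D [G hb ->]]]]] := gen_ideal_homogeneous oV Ja.
rewrite pb_sumr //.
elim/big_ind: _ => [||i _].
- by apply: ideal_at_gen => //; exact: gen_ideal0.
- by move=> a1 a2; exact: ideal_atD.
have [m [hg _ _]] := ideal_gen_hdeg oV (G i).
rewrite (pb_leibniz S oV (hth oV) (hb i) hg); apply: ideal_atD => //.
  by apply: ideal_at_gen => //; apply: gen_idealMl; exact: gen_ideal_gen.
do 2![apply: ideal_at_Ml => //].
case: (G i) => [f sf f0|s sin|X B atX tX tB].
- have [t tin ->] := pb_Theta_ideal0 oV sf f0.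
  by apply: ideal_at_gen => //; apply: gen_ideal_gen; exact: Ideal1.
- have [X' [D' [atX' tX' tD' ->]]] := pb_Theta_ideal1 oV sin.
  by apply: ideal_at_gen => //; apply: gen_ideal_gen; exact: Ideal2.
- exact: pb_Theta_ideal2.
Qed.

End Sufficiency.

(** * From reducibility to the conditions on the anchor and the bracket *)

Section Necessity.
Hypothesis red : reducible N K P d Theta.

Lemma pb_Theta_sec_ideal U s (x : M) : open U -> section_in N K U s -> U x -> N x ->
  exists V, [/\ open V, V x, V `<=` U & J (pb S (th V) (sec P V s))].
Proof.
move=> oU sin Ux Nx.
have van : vanishing_ideal N K P d (sec P U s).
  move=> y Uy Ny; exists U; split => //.
  by rewrite res_id //; apply: gen_ideal_gen; exact: Ideal1.
have [V [oV Vx VU JV]] := red oU van Ux Nx.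
exists V; split => //; move: JV.
by rewrite -/(gen_ideal _ _ _ _ _) res_pb // res_comp // res_sec //; exact: sin.1.
Qed.

(** Tangency is tested on the equations of N: rho(u) y_j is the value at x of {{Theta, s}, y_j}, an
    element of degree 0 of the ideal, hence a function vanishing on N. *)
Lemma anchor_tangent (x : M) (u : E x) : N x -> K x u -> tangent_to N d x (rho u).
Proof.
move=> Nx Ku; have [c sc cx] := hN.2 x Nx.
have [U [s [oU Ux Uc sin <-]]] := exists_section_in (@cdom_open _ _ _ c) cx Nx Ku.
have [V [oV Vx VU JV]] := pb_Theta_sec_ideal oU sin Ux Nx.
have [[tv _ _] _ _ _] := courant.
apply: (tangent_to_slice sc cx) => // j dj.
have sy : smooth_on V (fun z => cmap c z ord0 j).
  apply: (@smooth_on_sub _ _ (cdom c)) => [z /VU/Uc //|].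
  by apply: smooth_on_coord; case: sc.
have y0 z : V z -> N z -> cmap c z ord0 j = 0.
  by move=> /VU/Uc cz Nz; have := (sc.2 z cz).1 Nz; apply.
have ssV := smooth_sec_sub VU sin.1.
have hy := fn_hdeg C oV sy.
have h2 : hdeg 2 (pb S (th V) (sec P V s)).
  exact: (pb_hdeg S oV (hth oV) (sec_hdeg P oV ssV)).
have h0 : hdeg 0 (pb S (pb S (th V) (sec P V s)) (fn C V (fun z => cmap c z ord0 j))).
  exact: (pb_hdeg S oV h2 hy).
have [g sg gE] := fn_onto oV h0.
rewrite -(anchor_value oV ssV sy sg gE Vx).
apply: (gen_ideal_deg0 (N := N) (K := K) (P := P) (d := d) oV sg _ Vx Nx).
rewrite -gE (pb_anti S oV h2 hy) muln0 expr0 mul1r; apply: gen_idealN.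
exact: gen_ideal_pb_fn.
Qed.

(** Near each point of N, {{Theta, e1}, e2} is an element of degree 1 of the ideal, hence a section
    with values in K along N. *)
Lemma bracket_section_in e1 e2 : section_in N K setT e1 -> section_in N K setT e2 ->
  section_in N K setT (br e1 e2).
Proof.
move=> in1 in2; have [_ _ sbr bracket] := courant.
have sb := sbr e1 e2 in1.1 in2.1.
split => // x _ Nx.
have [V [oV Vx _ JV]] := pb_Theta_sec_ideal oT in1 I Nx.
have in2V : section_in N K V e2.
  by split; [exact: smooth_sec_sub in2.1|move=> y _; exact: in2.2].
have s1V : smooth_sec V e1 by exact: smooth_sec_sub in1.1.
have sbV : smooth_sec V (br e1 e2) by exact: smooth_sec_sub sb.
suff : J (sec P V (br e1 e2)).
  by move=> /(gen_ideal_deg1 K_perp oV sbV)[_]; apply.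
rewrite -(res_sec P oT oV (@subT V) sb) bracket //; [|exact: in1.1|exact: in2.1].
rewrite !res_pb // !res_sec //; [|exact: in2.1|exact: in1.1].
have h2 : hdeg 2 (pb S (res V Theta) (sec P V e1)).
  exact: (pb_hdeg S oV (hth oV) (sec_hdeg P oV s1V)).
rewrite (pb_anti S oV h2 (sec_hdeg P oV in2V.1)) -signr_odd expr0 mul1r.
by apply: gen_idealN; exact: gen_ideal_pb_sec.
Qed.

End Necessity.

End Reducibility.

Theorem corollary6p9 (R : realType) (M : manifold R) (C : Nmanifold2 M)
    (S : symplectic C) (E : pe_bundle M) (P : corresponds S E)
    (N : set M) (d : nat) (hN : submanifold N d)
    (K : forall x, set (E x)) (q : nat) (hK : lagrangian_subbundle N K q)
    (Theta : C setT) (hTheta : Courant_function S Theta)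
    (rho : forall x, E x -> (M -> R) -> R)
    (br : section E -> section E -> section E)
    (hcourant : Courant_structure_of P Theta rho br) :
  reducible N K P d Theta <->
  ((forall x (u : E x), N x -> K x u -> tangent_to N d x (rho x u)) /\
   (forall e1 e2, section_in N K setT e1 -> section_in N K setT e2 ->
      section_in N K setT (br e1 e2))).
Proof.
case: hK => K_sub K_perp; case: hTheta => Theta3 _.
split=> [red|[rhoK brK]].
  split=> [x u Nx Ku|e1 e2 in1 in2].
    exact: (anchor_tangent hN K_sub K_perp Theta3 hcourant red Nx Ku).
  exact: (bracket_section_in K_perp Theta3 hcourant red in1 in2).
exact: (reducible_sufficient hN K_sub K_perp Theta3 hcourant rhoK brK).
Qed.
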